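(* Let $0<\alpha<\pi$, $a=\cos\alpha$, $\beta=d(\theta,\mathcal P_\alpha)$, $2\le k\le n-1$. If $f(\eta)\equiv f_0(\eta_n)$, then $$(R^{\pm}f)(\theta,\xi)=u_{\pm}(\theta)\,\Phi_{\pm}(v_{\pm}(\theta)),$$ where $$u_\pm(\theta)=\frac{\Gamma(k/2)}{\pi^{1/2}}\,(\sin\beta\,\sin(\alpha\mp\beta))^{2-k},\qquad v_\pm(\theta)=\cos(\alpha\mp2\beta),$$ $$\Phi_+(t)=\frac{1}{\Gamma((k-1)/2)}\int_a^t f_1(s)\,(t-s)^{(k-3)/2}\,ds,\quad t\in(a,1),$$ $$\Phi_-(t)=\frac{1}{\Gamma((k-1)/2)}\int_t^a f_1(s)\,(s-t)^{(k-3)/2}\,ds,\quad t\in(-1,a),$$ $$f_1(s)=f_0(s)\,|s-a|^{(k-3)/2}.$$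
   Context: $\mathbb S^{n-1}$, $n\ge3$, is the unit sphere in $\mathbb R^n$ with geodesic distance $d(\cdot,\cdot)$ and north pole $e_n=(0,\dots,0,1)$. $\mathcal P_\alpha=\{\eta\in\mathbb S^{n-1}:d(e_n,\eta)=\alpha\}$, $\mathbb S_\alpha^+=\{\eta\in\mathbb S^{n-1}:d(e_n,\eta)<\alpha\}$, $\mathbb S_\alpha^-=\{\eta\in\mathbb S^{n-1}:d(e_n,\eta)>\alpha\}$. $\Gamma_\alpha^\pm$ denotes the collection of $(k-1)$-dimensional sections of $\mathbb S^{n-1}$ by $k$-dimensional affine planes that are tangent to $\mathcal P_\alpha$ and meet the interior of the unit ball, the sections being contained in the closure of $\mathbb S_\alpha^\pm$. These sections are parametrized as $\gamma(\theta,\xi)$, where $\theta\in\mathbb S_\alpha^\pm$ is the center of the section, viewed as a geodesic sphere, and $\xi\in G_k(\theta^\perp)$, the Grassmann manifold of all $k$-dimensional linear subspaces of $\theta^\perp$; the fiber over $\theta$ is taken to be the set of all $k$-dimensional linear subspaces of $\theta^\perp$. The transforms are $$(R^\pm f)(\theta,\xi)=\int_{\gamma(\theta,\xi)}f(\eta)\,d_{\theta,\xi}\eta,\qquad\gamma(\theta,\xi)\in\Gamma_\alpha^\pm,$$ with $d_{\theta,\xi}\eta$ the normalized surface area measure on $\gamma(\theta,\xi)$; that is, $$(R^\pm f)(\theta,\xi)=\frac1{\sigma_{k-1}}\int_{\mathbb S^{n-1}\cap\xi}f(\sin\beta\,\eta+\cos\beta\,\theta)\,d\eta,\qquad \beta=d(\theta,\mathcal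 P_\alpha),$$ where $\sigma_{k-1}=2\pi^{k/2}/\Gamma(k/2)$.
   Formalization: Only those ξ are considered for which γ(θ,ξ) is tangent to P_α and lies in Γ_α^± (for arbitrary ξ in G_k(θ^⊥), k<n-1, the formula fails); θ=e_n (for +) and θ=-e_n (for -) are excluded, as v_±=a lies outside the domain of Φ_± there; f_0 is Borel measurable on [-1,1]. *)

(* Defs.v *)
From HB Require Import structures.
From mathcomp Require Import all_boot all_order all_algebra.
From mathcomp Require Import all_classical all_reals all_analysis.
From mathcomp Require Import measurable_realfun.
Import Order.TTheory GRing.Theory Num.Theory.
Import numFieldNormedType.Exports.

Set Implicit Arguments.
Unset Strict Implicit.
Unset Printing Implicit Defensive.

Local Open Scope classical_set_scope.
Local Open Scope ring_scope.

(* Gamma(x) for x > 0. *)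
Definition euler_Gamma (R : realType) (x : R) : R :=
  \int[@lebesgue_measure R]_(t in `]0%R, +oo[) (t `^ (x - 1) * expR (- t)).

Section lebesgue_tuple.
Context {R : realType}.

Definition tcons k (p : R * k.-tuple R) : k.+1.-tuple R :=
  [tuple of p.1 :: p.2].

Lemma measurable_tcons k : measurable_fun setT (@tcons k).
Proof. exact: (measurable_cons measurable_fst measurable_snd). Qed.

Section leb_step.
Context k (m : {sigma_finite_measure set (k.-tuple R) -> \bar R}).

Definition leb_step : set (k.+1.-tuple R) -> \bar R :=
  pushforward (@lebesgue_measure R \x m)%E (@tcons k).

Let tcons_preimage (A : set (k.+1.-tuple R)) :
  measurable A -> measurable (@tcons k @^-1` A).
Proof. by move=> mA; rewrite -[X in measurable X]setTI; exact: measurable_tcons. Qed.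

Let leb_step0 : leb_step set0 = 0%E.
Proof. by rewrite /leb_step /pushforward preimage_set0 measure0. Qed.

Let leb_step_ge0 A : (0 <= leb_step A)%E.
Proof. by rewrite /leb_step /pushforward measure_ge0. Qed.

Let leb_step_sigma_additive : semi_sigma_additive leb_step.
Proof.
move=> F mF tF mUF; rewrite /leb_step /pushforward preimage_bigcup.
apply: measure_semi_sigma_additive.
- by move=> n; exact: tcons_preimage.
- apply/trivIsetP => /= i j _ _ ij; rewrite -preimage_setI.
  by move/trivIsetP : tF => /(_ _ _ _ _ ij) ->//; rewrite preimage_set0.
- by rewrite -preimage_bigcup; exact: tcons_preimage.
Qed.

HB.instance Definition _ := isMeasure.Build _ _ _ leb_step
  leb_step0 leb_step_ge0 leb_step_sigma_additive.

Let leb_step_sigma_finite : sigma_finite setT leb_step.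
Proof.
have /sigma_finiteP[F [FT ndF Foo]] := sigma_finiteT (@lebesgue_measure R).
have /sigma_finiteP[G [GT ndG Goo]] := sigma_finiteT m.
pose g (z : k.+1.-tuple R) := (thead z, [tuple of behead z]).
have mg : measurable_fun setT g.
  by apply/measurable_fun_pairP; split;
    [exact: measurable_tnth|exact: measurable_behead].
have gK : cancel (@tcons k) g.
  by case=> x y; rewrite /g /tcons /=; congr pair; exact/val_inj.
exists (fun i => g @^-1` (F i `*` G i)).
  apply/esym; rewrite -subTset => z _.
  have [i _ Fi] : (\bigcup_i F i) (g z).1 by rewrite -FT.
  have [j _ Gj] : (\bigcup_i G i) (g z).2 by rewrite -GT.
  exists (maxn i j) => //; split.
  - by move: Fi; exact/subsetPset/ndF/leq_maxl.
  - by move: Gj; exact/subsetPset/ndG/leq_maxr.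
move=> i; have [mF Fi] := Foo i; have [mG Gi] := Goo i; split.
  by rewrite -[X in measurable X]setTI; apply: mg => //; exact: measurableX.
rewrite /leb_step /pushforward -comp_preimage.
rewrite (_ : g \o _ = idfun) ?preimage_id; last exact/funext.
rewrite product_measure1E//.
by rewrite lte_mul_pinfty// ge0_fin_numE.
Qed.

HB.instance Definition _ := @Measure_isSigmaFinite.Build _ _ _ leb_step
  leb_step_sigma_finite.

End leb_step.

(* Lebesgue measure on R^k, as an iterated product. *)
Fixpoint leb (k : nat) : {sigma_finite_measure set (k.-tuple R) -> \bar R} :=
  match k with
  | 0 => \d_([tuple] : 0.-tuple R)
  | k'.+1 => leb_step (leb k')
  end.

Definition tnorm k (x : k.-tuple R) : R :=
  Num.sqrt (\sum_(i < k) tnth x i ^+ 2).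

Definition tnormalize k (x : k.-tuple R) : k.-tuple R :=
  [tuple tnth x i / tnorm x | i < k].

Lemma tnormE k (x : k.-tuple R) :
  tnorm x = (\sum_(i < k) tnth x i ^+ 2) `^ 2^-1.
Proof. by rewrite powR12_sqrt// sumr_ge0// => i _; exact: sqr_ge0. Qed.

Lemma measurable_sumsq k :
  measurable_fun setT (fun x : k.-tuple R => \sum_(i < k) tnth x i ^+ 2).
Proof.
by apply: measurable_sum => i; apply: measurable_funX; exact: measurable_tnth.
Qed.

Lemma measurable_tnorm k : measurable_fun setT (@tnorm k).
Proof.
rewrite (_ : @tnorm k = fun x => (\sum_(i < k) tnth x i ^+ 2) `^ 2^-1).
  exact: (measurableT_comp (measurable_powR 2^-1) (@measurable_sumsq k)).
by apply/funext => x; exact: tnormE.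
Qed.

Lemma measurable_tnormalize k : measurable_fun setT (@tnormalize k).
Proof.
apply/measurable_fun_tnthP => i.
rewrite (_ : _ \o _ =
    fun x => tnth x i * (\sum_(i < k) tnth x i ^+ 2) `^ (- 2^-1)).
  apply: measurable_funM; first exact: measurable_tnth.
  exact: (measurableT_comp (measurable_powR (- 2^-1)) (@measurable_sumsq k)).
by apply/funext => x /=; rewrite tnth_mktuple tnormE powRN.
Qed.

(* {r y | y in E, 0 < r <= 1}, for E a subset of the unit sphere *)
Definition cone k (E : set (k.-tuple R)) : set (k.-tuple R) :=
  [set x | 0 < tnorm x <= 1 /\ E (tnormalize x)].

(* Surface area measure of the unit sphere of R^k: k times the volume of the
   cone. *)
Definition sphere_measure k (E : set (k.-tuple R)) : \bar R :=
  (k%:R%:E * leb k (cone E))%E.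

Lemma measurable_cone k (E : set (k.-tuple R)) :
  measurable E -> measurable (cone E).
Proof.
move=> mE; rewrite (_ : cone E =
    (setT `&` @tnorm k @^-1` `]0, 1]) `&` (setT `&` @tnormalize k @^-1` E)).
  by apply: measurableI; [apply: measurable_tnorm|exact: measurable_tnormalize].
by rewrite !setTI; apply/seteqP; split => x; rewrite /cone /= in_itv.
Qed.

Section sphere_measure_measure.
Context (k : nat).

Let sphere_measure0 : sphere_measure (@set0 (k.-tuple R)) = 0%E.
Proof.
rewrite /sphere_measure (_ : cone _ = set0) ?measure0 ?mule0//.
by apply/seteqP; split => x // [].
Qed.

Let sphere_measure_ge0 (E : set (k.-tuple R)) : (0 <= sphere_measure E)%E.
Proof. by rewrite /sphere_measure mule_ge0// lee_fin. Qed.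

Let sphere_measure_sigma_additive : semi_sigma_additive (@sphere_measure k).
Proof.
move=> F mF tF mUF; rewrite /sphere_measure.
have UC : cone (\bigcup_n F n) = \bigcup_n cone (F n).
  apply/seteqP; split => [x [x1 [n _ Fn]]|x [n _ [x1 Fn]]].
    by exists n.
  by split => //; exists n.
rewrite UC; under eq_fun do rewrite -ge0_sume_distrr//.
apply: cvgeZl => //; apply: measure_semi_sigma_additive.
- by move=> n; exact: measurable_cone.
- apply/trivIsetP => i j _ _ ij; apply/seteqP; split => // x [[_ Fi] [_ Fj]].
  move/trivIsetP : tF => /(_ _ _ Logic.I Logic.I ij) F0.
  by have : (F i `&` F j) (tnormalize x) by []; rewrite F0.
- by rewrite -UC; exact: measurable_cone.
Qed.

HB.instance Definition _ := isMeasure.Build _ _ _ (@sphere_measure k)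
  sphere_measure0 sphere_measure_ge0 sphere_measure_sigma_additive.

End sphere_measure_measure.

End lebesgue_tuple.

Section spherical_geometry.
Context {R : realType} {n : nat}.
Implicit Types (x y p theta eta : 'rV[R]_n) (xi V : {vspace 'rV[R]_n}).

Definition dot x y : R := \sum_(i < n) x 0 i * y 0 i.

Definition sphere : set 'rV[R]_n := [set eta | dot eta eta = 1].

(* e_n = (0, ..., 0, 1) *)
Definition npole : 'rV[R]_n := \row_(j < n) (j.+1 == n)%:R.

(* the last coordinate eta_n *)
Definition lastc eta : R := dot eta npole.

Definition gdist x y : R := acos (dot x y).

Definition gdist_set x (A : set 'rV[R]_n) : R := inf [set gdist x y | y in A].

Definition parallel (alpha : R) : set 'rV[R]_n :=
  [set eta | sphere eta /\ gdist npole eta = alpha].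

Definition cap_plus (alpha : R) : set 'rV[R]_n :=
  [set eta | sphere eta /\ gdist npole eta < alpha].

Definition cap_minus (alpha : R) : set 'rV[R]_n :=
  [set eta | sphere eta /\ alpha < gdist npole eta].

Definition beta (alpha : R) theta : R := gdist_set theta (parallel alpha).

(* G_k(theta^perp) *)
Definition grass_perp (k : nat) theta : set {vspace 'rV[R]_n} :=
  [set xi | \dim xi = k /\ forall x, x \in xi -> dot x theta = 0].

Definition affine_plane p V : set 'rV[R]_n := [set p + v | v in [set` V]].

(* The plane p + V cuts the sphere in a sphere whose tangent space at p is the
   part of V orthogonal to p; the tangent space of the parallel at p is the
   orthogonal complement of p and e_n. The first has dimension k - 1 and the
   second n - 2, so for hyperplanes the inclusion is an equality. *)
Definition tangent_at (alpha : R) p V : Prop :=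
  parallel alpha p /\
  forall v, v \in V -> dot v p = 0 -> dot v npole = 0.

(* Gamma_alpha^+ and Gamma_alpha^-, with C the corresponding open cap *)
Definition tangent_sections (alpha : R) (k : nat) (C : set 'rV[R]_n) :
    set (set 'rV[R]_n) :=
  [set S | exists p V,
    [/\ \dim V = k,
        tangent_at alpha p V,
        affine_plane p V `&` [set x | dot x x < 1] !=set0,
        S = sphere `&` affine_plane p V
      & S `<=` closure C]].

(* gamma(theta, xi) *)
Definition slice (alpha : R) theta xi : set 'rV[R]_n :=
  [set sin (beta alpha theta) *: eta + cos (beta alpha theta) *: theta
    | eta in sphere `&` [set` xi]].

Definition is_orthobasis k xi (X : k.-tuple 'rV[R]_n) : Prop :=
  basis_of xi X /\
  forall i j : 'I_k, dot (tnth X i) (tnth X j) = (i == j)%:R.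

Definition orthobasis k xi : k.-tuple 'rV[R]_n :=
  xget [tuple 0 | _ < k] [set X | is_orthobasis xi X].

(* Integral over the unit sphere of the k-dimensional space xi with respect to
   its surface area, transported from R^k by an orthonormal basis of xi; by
   rotation invariance the choice of the basis is immaterial. *)
Definition sphere_integral k xi (g : 'rV[R]_n -> R) : \bar R :=
  \int[@sphere_measure R k]_(x in [set x | tnorm x = 1])
    (g (\sum_(i < k) tnth x i *: tnth (orthobasis k xi) i))%:E.

(* sigma_{k-1} *)
Definition sphere_area (k : nat) : R :=
  2 * pi `^ (k%:R / 2) / euler_Gamma (k%:R / 2).

(* The common formula for R^+ and R^-. Integrals are extended-real valued, so
   that functions with a divergent integral need not be excluded. *)
Definition slice_transform (alpha : R) (k : nat) (f : 'rV[R]_n -> R)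
    theta xi : \bar R :=
  ((sphere_area k)^-1%:E *
   sphere_integral k xi (fun eta =>
     f (sin (beta alpha theta) *: eta + cos (beta alpha theta) *: theta)%R))%E.

Definition u_plus (k : nat) (alpha : R) theta : R :=
  let b := beta alpha theta in
  euler_Gamma (k%:R / 2) / pi `^ (1 / 2)
    * (sin b * sin (alpha - b)) `^ (2 - k%:R).

Definition u_minus (k : nat) (alpha : R) theta : R :=
  let b := beta alpha theta in
  euler_Gamma (k%:R / 2) / pi `^ (1 / 2)
    * (sin b * sin (alpha + b)) `^ (2 - k%:R).

Definition v_plus (alpha : R) theta : R := cos (alpha - 2 * beta alpha theta).

Definition v_minus (alpha : R) theta : R := cos (alpha + 2 * beta alpha theta).

End spherical_geometry.

Section one_dimensional_integrals.
Context {R : realType}.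
Implicit Types (k : nat) (a t s : R).

Definition f1 k a (f0 : R -> R) s : R := f0 s * `|s - a| `^ ((k%:R - 3) / 2).

Definition Phi_plus k a (f0 : R -> R) t : \bar R :=
  ((euler_Gamma ((k%:R - 1) / 2))^-1%:E *
   \int[@lebesgue_measure R]_(s in `]a, t[)
     (f1 k a f0 s * (t - s) `^ ((k%:R - 3) / 2))%:E)%E.

Definition Phi_minus k a (f0 : R -> R) t : \bar R :=
  ((euler_Gamma ((k%:R - 1) / 2))^-1%:E *
   \int[@lebesgue_measure R]_(s in `]t, a[)
     (f1 k a f0 s * (s - t) `^ ((k%:R - 3) / 2))%:E)%E.

End one_dimensional_integrals.

(* Main.v *)
(* A section tangent to the parallel touches it at a point of the form
   [sin b *: eta + cos b *: theta] with [eta] a unit vector of [xi]. Reading off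
   its height shows that [eta], up to sign, is the normalized projection of the
   north pole on the orthogonal of [theta]; hence on the section the height is
   the affine function [cos b cos d + sin b sin d * t] of one coordinate [t] of
   the unit sphere of [xi], where [d] is the distance from [theta] to the pole.
   The formula then follows from the law of a coordinate on the unit sphere of
   R^k, which has density proportional to [(1 - t^2)^((k-3)/2)], by an affine
   change of variables. That density is obtained from the cone definition of the
   surface measure: plane rotations make the coordinate the first one, the
   remaining k-1 variables are integrated radially, and the slope y/r replaces
   the angle in the half plane of the pairs (first coordinate, radius of the
   rest). The radial constants are fixed by the Gaussian integral. *)
From HB Require Import structures.
Require Import Defs.
From mathcomp Require Import all_boot all_order all_algebra.
From mathcomp Require Import all_classical all_reals all_analysis.
From mathcomp Require Import measurable_realfun gauss_integral.
From mathcomp Require Import ring lra.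
Import Order.TTheory GRing.Theory Num.Theory.
Import numFieldNormedType.Exports.

Set Implicit Arguments.
Unset Strict Implicit.
Unset Printing Implicit Defensive.

Local Open Scope classical_set_scope.
Local Open Scope ring_scope.

(** * Densities and substitution *)

Import HBNNSimple.

(** The integral formula holds for indicators by construction, passes to simple functions by summing
    over their values, and to [f] by monotone convergence along [nnsfun_approx] on both sides. *)
Lemma ge0_density_measure d (T : measurableType d) (R : realType)
    (mu : {measure set T -> \bar R}) (w : T -> R) :
    measurable_fun setT w -> (forall x, 0 <= w x) ->
  exists2 nu : {measure set T -> \bar R},
    forall A, measurable A -> nu A = (\int[mu]_(x in A) (w x)%:E)%E &
    forall f : T -> \bar R, measurable_fun setT f ->
      (forall x, 0 <= f x)%E ->
      (\int[nu]_x f x = \int[mu]_x (f x * (w x)%:E))%E.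
Proof.
move=> mw w0; pose m (A : set T) := (\int[mu]_(x in A) (w x)%:E)%E.
have mwE : measurable_fun setT (EFin \o w) by exact/measurable_EFinP.
have m0 : m set0 = 0%E by rewrite /m integral_set0.
have m_ge0 A : (0 <= m A)%E by apply: integral_ge0 => x _; rewrite lee_fin.
have mS : semi_sigma_additive m.
  move=> F mF tF mUF; rewrite /m ge0_integral_bigcup//=; last first.
  - by move=> x _; rewrite lee_fin.
  - exact: measurable_funTS.
  by apply: is_cvg_ereal_nneg_natsum => n _; exact: m_ge0.
pose nu : {measure set T -> \bar R} :=
  HB.pack m (isMeasure.Build _ _ _ m m0 m_ge0 mS).
exists nu => // f mf f0.
pose f_ := nnsfun_approx measurableT mf.
have indicE (A : set T) : measurable A ->
    (\int[nu]_x (\1_A x)%:E = \int[mu]_x ((\1_A x)%:E * (w x)%:E))%E.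
  move=> mA; rewrite integral_indic// setIT /nu/= /m integral_mkcond.
  by apply: eq_integral => x _; rewrite epatch_indic muleC.
have sfunE (g : {nnsfun T >-> R}) :
    (\int[nu]_x (g x)%:E = \int[mu]_x ((g x)%:E * (w x)%:E))%E.
  have mg1 r : measurable (g @^-1` [set r]) by exact: measurable_funPTI.
  under eq_integral do rewrite fimfunE -fsumEFin//.
  rewrite ge0_integral_fsum//; last 2 first.
  - by move=> r; exact/measurable_EFinP/measurable_funM.
  - by move=> r x _; rewrite EFinM nnfun_muleindic_ge0.
  under [RHS]eq_integral.
    move=> x _; rewrite fimfunE -fsumEFin// ge0_mule_fsuml; last first.
      by move=> r; rewrite EFinM nnfun_muleindic_ge0.
    over.
  rewrite ge0_integral_fsum//; last 2 first.
  - move=> r; apply: emeasurable_funM => //.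
    exact/measurable_EFinP/measurable_funM.
  - by move=> r x _; rewrite mule_ge0 ?EFinM ?nnfun_muleindic_ge0 ?lee_fin.
  apply: eq_fsbigr => r; rewrite inE => -[x _ gx].
  have r0 : 0 <= r by rewrite -gx.
  under eq_integral do rewrite EFinM.
  under [RHS]eq_integral do rewrite EFinM -muleA.
  have mi : measurable_fun setT (fun x => (\1_(g @^-1` [set r]) x : R)%:E).
    by apply: measurableT_comp => //; exact: measurable_indic.
  rewrite ge0_integralZl// ge0_integralZl//; last 2 first.
  - exact: emeasurable_funM.
  - by move=> y _; rewrite mule_ge0// lee_fin.
  by rewrite indicE.
transitivity (limn (fun n => \int[nu]_x (f_ n x)%:E)%E).
  rewrite -monotone_convergence//.
  - apply: eq_integral => x _; apply/esym/cvg_lim => //.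
    by apply: cvg_nnsfun_approx.
  - by move=> n; exact/measurable_EFinP/measurable_funP.
  - by move=> n y _; rewrite lee_fin.
  - by move=> y _ i j ij; rewrite lee_fin; exact/lefP/nd_nnsfun_approx.
under eq_fun do rewrite sfunE.
rewrite -monotone_convergence//.
- apply: eq_integral => x _; apply/cvg_lim => //.
  apply: cvgeZr => //; by apply: cvg_nnsfun_approx.
- move=> n; apply: emeasurable_funM => //.
  exact/measurable_EFinP/measurable_funP.
- by move=> n y _; rewrite mule_ge0// lee_fin.
- move=> y _ i j ij; apply: lee_wpmul2r; rewrite lee_fin//.
  exact/lefP/nd_nnsfun_approx.
Qed.

(** Serves twice to lift an identity between measures of sets to integrals of functions: for the
    one-dimensional substitution, and for the surface measure as an image of Lebesgue measure. *)
Lemma ge0_density_pushforward d d' (X : measurableType d) (Y : measurableType d')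
    (R : realType) (mu : {measure set X -> \bar R}) (phi : X -> Y) (w : X -> R) :
    measurable_fun setT phi -> measurable_fun setT w -> (forall x, 0 <= w x) ->
  exists2 nu : {measure set Y -> \bar R},
    forall A, measurable A -> nu A = (\int[mu]_(x in phi @^-1` A) (w x)%:E)%E &
    forall f : Y -> \bar R, measurable_fun setT f -> (forall x, 0 <= f x)%E ->
      (\int[nu]_y f y = \int[mu]_x (f (phi x) * (w x)%:E))%E.
Proof.
move=> mphi mw w0; have [nu nuE intnu] := ge0_density_measure mu mw w0.
unshelve refine
  (ex_intro2 _ _ (pushforward nu phi : {measure set Y -> \bar R}) _ _) => //.
  move=> A mA; rewrite /= /pushforward nuE//.
  by rewrite -[X in measurable X]setTI; exact: mphi.
move=> f mf f0; rewrite ge0_integral_pushforward// preimage_setT intnu//.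
  exact: measurableT_comp.
by move=> x; exact: f0.
Qed.

(* By uniqueness of Lebesgue measure it suffices to compare both sides on
   half-open intervals, where the fundamental theorem of calculus applies. *)
Lemma ge0_integral_substitution (R : realType) (D : set R)
    (phi dphi psi : R -> R) (G : R -> \bar R) :
    open D -> is_interval D ->
    (forall s, D (psi s)) -> cancel psi phi ->
    (forall x, D x -> is_derive x 1 phi (dphi x)) ->
    (forall x, D x -> {for x, continuous dphi}) ->
    (forall x, D x -> 0 < dphi x) ->
    measurable_fun setT G -> (forall y, 0 <= G y)%E ->
  (\int[@lebesgue_measure R]_y G y =
   \int[@lebesgue_measure R]_(x in D) (G (phi x) * (dphi x)%:E))%E.
Proof.
move=> oD iD Dpsi psiK dphiE dphic dphi0 mG G0.
have mD : measurable D by exact: open_measurable.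
have phic x : D x -> {for x, continuous phi}.
  by move=> /dphiE[df _]; apply: differentiable_continuous; exact/derivable1_diffP.
have phi_incr : {in D &, {homo phi : x y / x < y}}.
  move=> x y /[!inE] Dx Dy xy.
  have Dxy z : x <= z <= y -> D z by exact: iD.
  have [||c] := @MVT _ phi dphi x y xy.
  - by move=> z /[!in_itv]/= /andP[xz zy]; apply/dphiE/Dxy; rewrite !ltW.
  - apply: continuous_in_subspaceT => z /[!inE]/= /[!in_itv]/= h.
    exact/phic/Dxy.
  rewrite in_itv/= => /andP[xc cy] e; rewrite -subr_gt0 e mulr_gt0 ?subr_gt0//.
  by apply/dphi0/Dxy; rewrite !ltW.
(* Extension by 0 makes both functions measurable on the whole line; the weight [w] vanishes outside
   [D], so that region contributes nothing. *)
pose w := dphi \_ D; pose f := phi \_ D.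
have mw : measurable_fun setT w.
  apply/(measurable_restrictT _ mD).
  by apply: open_continuous_measurable_fun => // x /[!inE]; exact: dphic.
have mf : measurable_fun setT f.
  apply/(measurable_restrictT _ mD).
  by apply: open_continuous_measurable_fun => // x /[!inE]; exact: phic.
have w0 x : 0 <= w x.
  by rewrite /w patchE; case: ifPn => // /[!inE] /dphi0/ltW.
have [nu nuE intnu] := @ge0_density_pushforward _ _
  (measurableTypeR R) (measurableTypeR R) R (@lebesgue_measure R) f w mf mw w0.
have leb_nu (A : set R) : measurable A -> lebesgue_measure A = nu A.
  apply: lebesgue_measure_unique => _ [[x y] _ <-] /=.
  rewrite nuE//.
  (* On [D] the map [phi] is increasing, so it takes values in []x, y]] exactly on []psi x, psi y]],
     which lies in the interval [D]. *)
  have -> : (\int[@lebesgue_measure R]_(z in f @^-1` `]x, y]) (w z)%:E =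
      \int[@lebesgue_measure R]_(z in `]psi x, psi y]) (dphi z)%:E)%E.
    rewrite integral_mkcond [RHS]integral_mkcond; apply: eq_integral => z _.
    rewrite !patchE /=.
    have [zD|zD] := pselect (D z); last first.
      rewrite [X in _ = (if X then _ else _)](_ : _ = false).
        rewrite /w patchE; case: ifPn => // _; rewrite ifF//.
        by apply/negbTE/negP; rewrite inE.
      apply/negbTE/negP; rewrite inE /= in_itv /= => /andP[z1 z2].
      by apply: zD; apply: (iD _ _ (Dpsi x) (Dpsi y)); rewrite ltW.
    have phiE s t : D s -> D t -> (phi s < phi t) = (s < t).
      move=> Ds Dt; have [st|ts|->] := ltgtP s t; last by rewrite ltxx.
        by rewrite phi_incr// inE.
      by apply/negbTE; rewrite -leNgt ltW// phi_incr// inE.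
    rewrite /w patchE (mem_set zD); congr (if _ then _ else _).
    apply/idP/idP; rewrite !inE /= /f patchE (mem_set zD) !in_itv /=.
      by rewrite -{1}(psiK x) -{1}(psiK y) phiE// !leNgt phiE.
    by rewrite -{2}(psiK x) -{2}(psiK y) phiE// !leNgt phiE.
  rewrite lebesgue_measure_itv /= lte_fin.
  have [xy|yx] := ltP x y; last first.
    rewrite set_itv_ge ?integral_set0// bnd_simp -leNgt.
    rewrite leNgt; apply/negP => h.
    have := phi_incr _ _ (mem_set (Dpsi x)) (mem_set (Dpsi y)) h.
    by rewrite !psiK ltNge yx.
  have pxy : psi x < psi y.
    rewrite ltNge le_eqVlt; apply/negP => /orP[/eqP e|h].
      by move: xy; rewrite -(psiK x) -(psiK y) e ltxx.
    have := phi_incr _ _ (mem_set (Dpsi y)) (mem_set (Dpsi x)) h.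
    by rewrite !psiK ltNge ltW.
  have DI z : psi x <= z <= psi y -> D z by exact: iD.
  rewrite integral_itv_obnd_cbnd; last first.
    apply/measurable_EFinP; apply: (measurable_funS mD).
      by move=> z /= /[!in_itv]/= /andP[z1 z2]; apply: DI; rewrite ltW.
    by apply: open_continuous_measurable_fun => // z /[!inE]; exact: dphic.
  rewrite (continuous_FTC2 pxy (F := phi)) ?psiK//.
  - apply: continuous_in_subspaceT => z /[!inE]/= /[!in_itv]/= h.
    exact/dphic/DI.
  - split.
    + by move=> z /[!in_itv]/= /andP[z1 z2]; have [] := dphiE _ (DI z _); rewrite ?ltW.
    + by apply: cvg_at_right_filter; exact: phic.
    + by apply: cvg_at_left_filter; exact: phic.
  - move=> z /[!in_itv]/= /andP[z1 z2]; rewrite derive1E.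
    by have [] := dphiE _ (DI z _); rewrite ?ltW.
transitivity (\int[nu]_y G y)%E.
  by apply: eq_measure_integral => A mA _; exact: leb_nu.
rewrite intnu// [RHS]integral_mkcond; apply: eq_integral => x _ /=.
rewrite /f /w !patchE; case: ifPn => //; by rewrite mule0.
Qed.

Lemma ge0_integral_affine (R : realType) (c b : R) (G : R -> \bar R) :
    0 < c -> measurable_fun setT G -> (forall y, 0 <= G y)%E ->
  (\int[@lebesgue_measure R]_x G (c * x + b)%R =
   c^-1%:E * \int[@lebesgue_measure R]_x G x)%E.
Proof.
move=> c0 mG G0.
have cG : measurable_fun setT (fun x => G (c * x + b)).
  apply: (measurableT_comp mG); apply: measurable_funD => //.
have -> : (\int[@lebesgue_measure R]_x G x =
    \int[@lebesgue_measure R]_x (G (c * x + b)%R * c%:E))%E.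
  apply: (@ge0_integral_substitution _ setT (fun x => c * x + b) (cst c)
    (fun s => c^-1 * (s - b))) => //.
  - exact: openT.
  - by move=> s; rewrite mulrA divff ?gt_eqF// mul1r subrK.
  - move=> x _; apply: is_derive_eq.
    by rewrite addr0 [_ *: _]mulr1.
  - by move=> x _; exact: cst_continuous.
under [in RHS]eq_integral do rewrite muleC.
rewrite ge0_integralZl//; last by rewrite lee_fin ltW.
by rewrite muleA -EFinM mulVf ?gt_eqF// mul1e.
Qed.

Lemma ge0_integral_oppr (R : realType) (G : R -> \bar R) :
    measurable_fun setT G -> (forall y, 0 <= G y)%E ->
  (\int[@lebesgue_measure R]_x G (- x)%R = \int[@lebesgue_measure R]_x G x)%E.
Proof.
move=> mG G0; rewrite -[X in integral _ X _](preimage_setT (-%R : R -> R)).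
rewrite -(@ge0_integral_pushforward _ _ (measurableTypeR R) (measurableTypeR R)
  R (-%R) _ lebesgue_measure setT G)//.
by apply: eq_measure_integral => //= A mA _; exact/lebesgue_measureN.
Qed.

(** * Iterated integrals and rotations *)

Lemma ge0_integral_leb_tcons (R : realType) (k : nat) (F : k.+1.-tuple R -> \bar R) :
    measurable_fun setT F -> (forall x, 0 <= F x)%E ->
  (\int[leb k.+1]_x F x =
   \int[@lebesgue_measure R]_y \int[leb k]_x F (tcons (y, x)))%E.
Proof.
move=> mF F0.
rewrite [LHS](@ge0_integral_pushforward _ _ (measurableTypeR R * k.-tuple R)%type
  _ R _ (@measurable_tcons R k)
  (lebesgue_measure \x leb k)%E setT F)// preimage_setT.
rewrite fubini_tonelli1//; last by move=> x; exact: F0.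
by apply: (measurableT_comp mF); exact: measurable_tcons.
Qed.

Lemma ge0_integral_leb0 (R : realType) (F : 0.-tuple R -> \bar R) :
    measurable_fun setT F -> (forall x, 0 <= F x)%E ->
  (\int[leb 0]_x F x = F [tuple])%E.
Proof. by move=> mF F0; rewrite [LHS]integral_dirac// diracT mul1e. Qed.

Lemma measurable_invr (R : realType) : measurable_fun setT (fun x : R => x^-1).
Proof.
have o0 : open (~` [set (0 : R)]).
  rewrite openC; apply: accessible_closed_set1.
  exact: (@hausdorff_accessible R (@Rhausdorff R)).
rewrite -(setUv [set (0 : R)]); apply/measurable_funU.
- exact: measurable_set1.
- exact: open_measurable.
split; first exact: measurable_fun_set1.
apply: open_continuous_measurable_fun => // x /[!inE] /eqP x0.
exact: inv_continuous.
Qed.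

Lemma measurable_sqrtr (R : realType) : measurable_fun setT (@Num.sqrt R).
Proof. exact: continuous_measurable_fun (@sqrt_continuous R). Qed.

(** The radial Jacobian, cut off at 0 so that radial integrals run over the whole line and full-line
    substitutions apply to them. *)
Definition pos_expr (R : realType) (m : nat) (r : R) : R := r ^+ m * (0 < r)%R%:R.

Lemma pos_expr_ge0 (R : realType) m (r : R) : 0 <= pos_expr m r.
Proof.
rewrite /pos_expr; case: ltP => [r0|_]; last by rewrite mulr0.
by rewrite mulr1 exprn_ge0// ltW.
Qed.

Lemma measurable_pos_expr (R : realType) m : measurable_fun setT (@pos_expr R m).
Proof.
rewrite (_ : @pos_expr R m = fun r => r ^+ m * \1_(`]0, +oo[%classic) r).
  apply: measurable_funM; first exact: measurable_funX.
  exact: measurable_indic.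
apply/funext => r; rewrite /pos_expr indicE; congr (_ * _%:R).
by rewrite mem_setE in_itv/= andbT.
Qed.

Definition tdot (R : realType) k (w x : k.-tuple R) : R :=
  \sum_(i < k) tnth w i * tnth x i.

Definition tsq (R : realType) k (x : k.-tuple R) : R :=
  \sum_(i < k) tnth x i ^+ 2.

Lemma measurable_tdot (R : realType) k (w : k.-tuple R) :
  measurable_fun setT (tdot w).
Proof.
apply: measurable_sum => i; apply: measurable_funM => //.
exact: measurable_tnth.
Qed.

Lemma measurable_tsq (R : realType) k : measurable_fun setT (@tsq R k).
Proof. exact: measurable_sumsq. Qed.

Ltac mfun := repeat first
  [ exact: measurable_cst | exact: measurable_id | exact: measurable_fst
  | exact: measurable_snd | exact: measurable_tnth | exact: measurable_tnorm
  | exact: measurable_tdot | exact: measurable_tsq | assumption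
  | apply: (measurableT_comp (@measurable_pos_expr _ _))
  | apply: (measurableT_comp (@measurable_tsq _ _))
  | apply: (measurableT_comp (@measurable_invr _))
  | apply: (measurableT_comp (@measurable_sqrtr _))
  | apply: measurable_fun_pair | apply: measurable_funX | apply: measurable_funB
  | apply: measurable_funD | apply: measurable_funN | apply: measurable_funM
  | progress (apply: (measurableT_comp measurable_fst))
  | progress (apply: (measurableT_comp measurable_snd)) ].

(* Two successive affine substitutions, in [y] then in [x], with Fubini in
   between: the rotation is never used as a map of the plane. *)
Lemma ge0_integral_rotation (R : realType) (c r : R) (H : R * R -> \bar R) :
    0 < r -> c ^+ 2 + r ^+ 2 = 1 ->
    measurable_fun setT H -> (forall p, 0 <= H p)%E ->
  (\int[@lebesgue_measure R]_x \int[@lebesgue_measure R]_y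
     H (c * x + r * y, x ^+ 2 + y ^+ 2)%R =
   \int[@lebesgue_measure R]_x \int[@lebesgue_measure R]_y
     H (x, x ^+ 2 + y ^+ 2)%R)%E.
Proof.
move=> r0 cr mH H0.
transitivity (\int[@lebesgue_measure R]_x \int[@lebesgue_measure R]_u
    (r^-1%:E * H (u, x ^+ 2 + ((u - c * x) / r) ^+ 2)%R))%E.
  apply: eq_integral => x _.
  have mK : measurable_fun setT
      (fun u : R => H (u, x ^+ 2 + ((u - c * x) / r) ^+ 2)).
    by apply: (measurableT_comp mH); mfun.
  rewrite ge0_integralZl//; last by rewrite lee_fin invr_ge0 ltW.
  rewrite -(ge0_integral_affine (c * x) r0 mK)//.
  apply: eq_integral => y _; congr (H (_, _)); first by rewrite addrC.
  by rewrite addrK mulrAC divff ?gt_eqF// mul1r.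
rewrite (@fubini_tonelli _ _ (measurableTypeR R) (measurableTypeR R) R
  lebesgue_measure lebesgue_measure
  (fun p => r^-1%:E * H (p.2, p.1 ^+ 2 + ((p.2 - c * p.1) / r) ^+ 2)%R)%E)/=.
- apply: eq_integral => u _.
  have mK : measurable_fun setT (fun v : R => H (u, u ^+ 2 + v ^+ 2)).
    by apply: (measurableT_comp mH); mfun.
  have rV0 : 0 < r^-1 by rewrite invr_gt0.
  have mL : measurable_fun setT
      (fun x : R => H (u, x ^+ 2 + ((u - c * x) / r) ^+ 2)).
    by apply: (measurableT_comp mH); mfun.
  rewrite ge0_integralZl//; last by rewrite lee_fin ltW.
  transitivity (r^-1%:E * \int[@lebesgue_measure R]_x
      H (u, u ^+ 2 + (r^-1 * x - c * u / r) ^+ 2)%R)%E.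
    congr (_ * _)%E; apply: eq_integral => x _; congr (H (_, _)).
    apply/eqP; rewrite -subr_eq0; apply/eqP.
    (* The two sums of squares differ by a multiple of [c ^+ 2 + r ^+ 2 - 1]: this is the invariance
       of the norm under the rotation. *)
    transitivity ((c ^+ 2 + r ^+ 2 - 1) * (x ^+ 2 - u ^+ 2) / r ^+ 2).
      by field; rewrite gt_eqF.
    by rewrite cr subrr !mul0r.
  rewrite (ge0_integral_affine (- (c * u / r)) rV0 mK)// invrK.
  by rewrite muleA -EFinM mulVf ?gt_eqF// mul1e.
- apply: measurable_funeM; apply: (measurableT_comp mH); mfun.
- by move=> p; rewrite mule_ge0// lee_fin invr_ge0 ltW.
Qed.

Lemma tdot_tcons (R : realType) k (a b : R) (w x : k.-tuple R) :
  tdot (tcons (a, w)) (tcons (b, x)) = a * b + tdot w x.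
Proof.
rewrite /tdot big_ord_recl; congr (_ + _).
by apply: eq_bigr => i _; rewrite !(tnth_nth 0).
Qed.

Lemma tsq_tcons (R : realType) k (a : R) (x : k.-tuple R) :
  tsq (tcons (a, x)) = a ^+ 2 + tsq x.
Proof.
rewrite /tsq big_ord_recl; congr (_ + _).
by apply: eq_bigr => i _; rewrite !(tnth_nth 0).
Qed.

Lemma tsq_ge0 (R : realType) k (x : k.-tuple R) : 0 <= tsq x.
Proof. by apply: sumr_ge0 => i _; exact: sqr_ge0. Qed.

Lemma tsq_eq0 (R : realType) k (w x : k.-tuple R) : tsq w = 0 -> tdot w x = 0.
Proof.
move=> /eqP; rewrite psumr_eq0; last by move=> i _; exact: sqr_ge0.
move=> /allP w0; apply: big1 => i _.
by have := w0 i (mem_index_enum _); rewrite sqrf_eq0 => /eqP ->; rewrite mul0r.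
Qed.

Lemma measurable_integral_leb d (T : measurableType d) (R : realType) k
    (F : T * k.-tuple R -> \bar R) :
    measurable_fun setT F -> (forall p, 0 <= F p)%E ->
  measurable_fun setT (fun p => \int[leb k]_x F (p, x))%E.
Proof. by move=> mF F0; exact: measurable_fun_fubini_tonelli_F. Qed.

(** The degenerate case of the projection formula: the unit vector has a vanishing tail that cannot
    be normalized, so [a] is 1 or -1, and the sign is removed by reflecting the line. *)
Lemma ge0_integral_leb_proj1 (R : realType) k (a : R) (w : k.-tuple R)
    (G : R * R -> \bar R) :
    tsq w = 0 -> a ^+ 2 = 1 -> measurable_fun setT G -> (forall p, 0 <= G p)%E ->
  (\int[leb k.+1]_x G (tdot (tcons (a, w)) x, tsq x) =
   \int[@lebesgue_measure R]_y \int[leb k]_x G (y, y ^+ 2 + tsq x)%R)%E.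
Proof.
move=> w0 a1 mG G0.
have mGd (v : k.+1.-tuple R) : measurable_fun setT (fun x => G (tdot v x, tsq x)).
  apply: (measurableT_comp mG); apply: measurable_fun_pair.
    exact: measurable_tdot.
  exact: measurable_tsq.
rewrite (ge0_integral_leb_tcons (mGd (tcons (a, w)))); last by move=> x; exact: G0.
pose g y := (\int[leb k]_x G (y, y ^+ 2 + tsq x)%R)%E.
have mg : measurable_fun setT g.
  rewrite /g; apply: (@measurable_integral_leb _ _ R k
    (fun p : R * k.-tuple R => G (p.1, p.1 ^+ 2 + tsq p.2)%R)) => //.
  apply: (measurableT_comp mG); mfun.
have g0 y : (0 <= g y)%E by exact: integral_ge0.
transitivity (\int[@lebesgue_measure R]_y g (a * y)%R)%E.
  apply: eq_integral => y _; apply: eq_integral => x _.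
  by rewrite tdot_tcons tsq_tcons tsq_eq0// addr0 exprMn a1 mul1r.
have /orP[/eqP ->|/eqP ->] : (a == 1) || (a == -1) by rewrite -sqrf_eq1 a1.
  by under eq_integral do rewrite mul1r.
under eq_integral do rewrite mulN1r.
exact: ge0_integral_oppr.
Qed.

(* The induction hypothesis, applied to the normalized tail of [w] in the last
   k.+1 variables, reduces the claim to a rotation of the plane. *)
Lemma ge0_integral_leb_proj (R : realType) k (w : k.+1.-tuple R)
    (G : R * R -> \bar R) :
    tsq w = 1 -> measurable_fun setT G -> (forall p, 0 <= G p)%E ->
  (\int[leb k.+1]_x G (tdot w x, tsq x) =
   \int[@lebesgue_measure R]_y \int[leb k]_x G (y, y ^+ 2 + tsq x)%R)%E.
Proof.
elim: k => [|k IH] in w G * => w1 mG G0.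
all: have wE : w = tcons (thead w, [tuple of behead w]) by exact: tuple_eta.
all: move: w1; rewrite wE tsq_tcons; set a := thead w; set w' := [tuple of behead w].
  rewrite {1}/tsq big_ord0 addr0 => a1.
  by rewrite ge0_integral_leb_proj1// /tsq big_ord0.
have [w0|w0 w1] := eqVneq (tsq w') 0.
  by rewrite w0 addr0 => a1; rewrite ge0_integral_leb_proj1.
pose r := Num.sqrt (tsq w').
have r0 : 0 < r by rewrite sqrtr_gt0 lt_neqAle eq_sym w0 tsq_ge0.
have r2 : r ^+ 2 = tsq w' by rewrite sqr_sqrtr// tsq_ge0.
pose u := [tuple tnth w' i / r | i < k.+1].
have u1 : tsq u = 1.
  rewrite /tsq; under eq_bigr do rewrite tnth_mktuple exprMn exprVn.
  by rewrite -mulr_suml -/(tsq w') r2 divff.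
have w'E x : tdot w' x = r * tdot u x.
  rewrite /tdot mulr_sumr; apply: eq_bigr => i _.
  by rewrite tnth_mktuple mulrA mulrC (mulrCA r) divff ?gt_eqF// mulr1 mulrC.
have mGd (v : k.+2.-tuple R) : measurable_fun setT (fun x => G (tdot v x, tsq x)).
  apply: (measurableT_comp mG); apply: measurable_fun_pair.
    exact: measurable_tdot.
  exact: measurable_tsq.
rewrite (ge0_integral_leb_tcons (mGd (tcons (a, w')))); last by move=> x; exact: G0.
(* The last [k] variables are integrated out, as the plane rotation leaves them fixed; the other two
   enter through one coordinate and their sum of squares. *)
pose H (p : R * R) := (\int[leb k]_x G (p.1, p.2 + tsq x)%R)%E.
have mH : measurable_fun setT H.
  apply: (@measurable_integral_leb _ _ R k
    (fun p : (R * R) * k.-tuple R => G (p.1.1, p.1.2 + tsq p.2)%R)) => //.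
  apply: (measurableT_comp mG); mfun.
have H0 p : (0 <= H p)%E by exact: integral_ge0.
have mGt : measurable_fun setT
    (fun q : R * k.+1.-tuple R => G (q.1, q.1 ^+ 2 + tsq q.2)).
  apply: (measurableT_comp mG); mfun.
transitivity (\int[@lebesgue_measure R]_x \int[@lebesgue_measure R]_y
    H (a * x + r * y, x ^+ 2 + y ^+ 2)%R)%E.
  apply: eq_integral => x _.
  transitivity (\int[leb k.+1]_z
      G (a * x + r * tdot u z, x ^+ 2 + tsq z)%R)%E.
    by apply: eq_integral => z _; rewrite tdot_tcons tsq_tcons w'E.
  rewrite (IH u (fun p => G (a * x + r * p.1, x ^+ 2 + p.2)%R) u1); last 2 first.
  - by apply: (measurableT_comp mG); mfun.
  - by move=> p; exact: G0.
  by apply: eq_integral => y _; apply: eq_integral => z _; rewrite addrA.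
rewrite ge0_integral_rotation//; last by rewrite r2.
apply: eq_integral => x _.
rewrite (ge0_integral_leb_tcons (measurable_fun_pair2 x mGt)); last first.
  by move=> z; exact: G0.
apply: eq_integral => y _; apply: eq_integral => z _.
by rewrite tsq_tcons addrA.
Qed.

(* Polar coordinates in the half plane [r > 0], with the slope [y / r] in place
   of the angle. *)
Lemma ge0_integral_polar (R : realType) (m : nat) (Q : R * R -> \bar R) :
    measurable_fun setT Q -> (forall p, 0 <= Q p)%E ->
  (\int[@lebesgue_measure R]_y \int[@lebesgue_measure R]_r
     ((pos_expr m r)%:E * Q (y / Num.sqrt (y ^+ 2 + r ^+ 2),
                             Num.sqrt (y ^+ 2 + r ^+ 2))%R) =
   \int[@lebesgue_measure R]_s
     ((Num.sqrt (1 + s ^+ 2) ^- m.+2)%:E *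
      \int[@lebesgue_measure R]_u
        ((pos_expr m.+1 u)%:E * Q (s / Num.sqrt (1 + s ^+ 2), u)%R)))%E.
Proof.
move=> mQ Q0.
pose q (s : R) := Num.sqrt (1 + s ^+ 2).
have q0 s : 0 < q s by rewrite sqrtr_gt0 ltr_wpDr// sqr_ge0.
have mq : measurable_fun setT q by rewrite /q; mfun.
rewrite (@fubini_tonelli _ _ (measurableTypeR R) (measurableTypeR R) R
  lebesgue_measure lebesgue_measure
  (fun p => (pos_expr m p.2)%:E * Q (p.1 / Num.sqrt (p.1 ^+ 2 + p.2 ^+ 2),
                             Num.sqrt (p.1 ^+ 2 + p.2 ^+ 2))%R)%E)/=; last 2 first.
- apply: emeasurable_funM; first by apply/measurable_EFinP; mfun.
  by apply: (measurableT_comp mQ); mfun.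
- by move=> p; rewrite mule_ge0// lee_fin pos_expr_ge0.
(* At fixed [r] the substitution [y = r * s] brings out one more factor [r], raising the weight from
   [m] to [m.+1]. *)
transitivity (\int[@lebesgue_measure R]_r \int[@lebesgue_measure R]_s
    ((pos_expr m.+1 r)%:E * Q (s / q s, r * q s)%R))%E.
  apply: eq_integral => r _.
  have [r0|r0] := ltP 0 r; last first.
    have p0 i : pos_expr i r = 0 by rewrite /pos_expr ltNge r0 mulr0.
    rewrite !p0; under eq_integral do rewrite mul0e.
    by under [RHS]eq_integral do rewrite mul0e.
  have mK : measurable_fun setT (fun y : R => Q (y / Num.sqrt (y ^+ 2 + r ^+ 2),
      Num.sqrt (y ^+ 2 + r ^+ 2))).
    by apply: (measurableT_comp mQ); mfun.
  rewrite ge0_integralZl//; last by rewrite lee_fin pos_expr_ge0.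
  rewrite [RHS]ge0_integralZl//; last 2 first.
  - by apply: (measurableT_comp mQ); mfun.
  - by rewrite lee_fin pos_expr_ge0.
  transitivity ((pos_expr m.+1 r)%:E * (r^-1%:E * \int[@lebesgue_measure R]_y
      Q (y / Num.sqrt (y ^+ 2 + r ^+ 2), Num.sqrt (y ^+ 2 + r ^+ 2))%R))%E.
    rewrite muleA -EFinM; congr (_%:E * _)%E.
    rewrite /pos_expr r0 !mulr1 exprS mulrC mulrA mulVf ?mul1r//.
    by rewrite gt_eqF.
  congr (_ * _)%E; rewrite -(ge0_integral_affine 0 r0 mK)//.
  apply: eq_integral => s _.
  have -> : Num.sqrt ((r * s + 0) ^+ 2 + r ^+ 2) = r * q s.
    rewrite addr0 exprMn -{2}[r ^+ 2]mulr1 -mulrDr sqrtrM ?sqr_ge0//.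
    by rewrite sqrtr_sqr gtr0_norm// addrC.
  congr (Q (_, _)); rewrite addr0 -mulf_div divff ?mul1r//.
  by rewrite gt_eqF.
rewrite (@fubini_tonelli _ _ (measurableTypeR R) (measurableTypeR R) R
  lebesgue_measure lebesgue_measure
  (fun p => (pos_expr m.+1 p.1)%:E * Q (p.2 / q p.2, p.1 * q p.2)%R)%E)/=; last 2 first.
- apply: emeasurable_funM; first by apply/measurable_EFinP; mfun.
  by apply: (measurableT_comp mQ); rewrite /q; mfun.
- by move=> p; rewrite mule_ge0// lee_fin pos_expr_ge0.
apply: eq_integral => s _.
have mK : measurable_fun setT
    (fun u => (pos_expr m.+1 u)%:E * Q (s / q s, u)%R)%E.
  apply: emeasurable_funM; first by apply/measurable_EFinP; mfun.
  by apply: (measurableT_comp mQ); mfun.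
have K0 u : (0 <= (pos_expr m.+1 u)%:E * Q (s / q s, u)%R)%E.
  by rewrite mule_ge0// lee_fin pos_expr_ge0.
have qV0 : (0 <= (q s ^- m.+1)%:E)%E by rewrite lee_fin invr_ge0 exprn_ge0// ltW.
(* The substitution [u = r * q s] at fixed [s] costs [q s ^- m.+1] for the weight and one more
   [(q s)^-1] for the Jacobian. *)
rewrite -/(q s); have -> : q s ^- m.+2 = q s ^- m.+1 * (q s)^-1.
  by rewrite exprS invfM mulrC.
rewrite EFinM -muleA -(ge0_integral_affine 0 (q0 s) mK)//.
rewrite -ge0_integralZl//; last first.
  apply: (measurableT_comp mK).
  by apply: measurable_funD => //; exact: measurable_funM.
apply: eq_integral => r _.
rewrite addr0 muleA -EFinM [q s * r]mulrC; congr (_%:E * _)%E.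
rewrite /pos_expr pmulr_lgt0// exprMn [RHS]mulrA; congr (_ * _).
by rewrite mulrC -mulrA divff ?mulr1// gt_eqF// exprn_gt0.
Qed.

(** * Radial integration *)

(** Radial integration in dimension one, where the sphere consists of two points. The origin is
    removed first as a null set, because [pos_expr] vanishes there while [F] need not. *)
Lemma ge0_integral_norm1 (R : realType) (F : R -> \bar R) :
    measurable_fun setT F -> (forall y, 0 <= F y)%E ->
  (\int[@lebesgue_measure R]_y F `|y|%R =
   2%:E * \int[@lebesgue_measure R]_y ((pos_expr 0 y)%:E * F y))%E.
Proof.
move=> mF F0.
pose g (y : R) := ((pos_expr 0 y)%:E * F y)%E.
have mg : measurable_fun setT g.
  by apply: emeasurable_funM => //; apply/measurable_EFinP; mfun.
have g0 y : (0 <= g y)%E by rewrite mule_ge0// lee_fin pos_expr_ge0.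
have mgN : measurable_fun setT (fun y : R => g (- y)) by apply: (measurableT_comp mg).
have gD (y : R) : y != 0 -> F `|y|%R = (g y + g (- y)%R)%E.
  move=> y0; rewrite /g /pos_expr !expr0 !mul1r oppr_gt0.
  have [y1|y1] := ltP 0 y.
    by rewrite ltNge (ltW y1) mul1e mul0e adde0 gtr0_norm.
  have {}y1 : y < 0 by rewrite lt_neqAle y0.
  by rewrite y1 mul0e mul1e add0e ltr0_norm.
have mT : measurable ([set: R] `\ 0) by exact: measurableD.
have mN : measurable_fun setT (fun y : R => F `|y|%R).
  by apply: (measurableT_comp mF); exact: normr_measurable.
rewrite -(@integral_setD1 R _ 0 setT)//; last exact: measurable_funTS.
under eq_integral.
  move=> y; rewrite inE => -[_ /eqP y0]; rewrite gD//; over.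
rewrite integral_setD1//; last first.
  by apply: measurable_funTS; exact: emeasurable_funD.
by rewrite ge0_integralD//= ge0_integral_oppr// -mule2n mule_natl.
Qed.

(** For positive [k], says that [C] is the surface area of the unit sphere of R^k. It is
    extended-real because the constant is built by induction before it is known to be finite. *)
Definition radial_const (R : realType) (k : nat) (C : \bar R) :=
  forall F : R -> \bar R, measurable_fun setT F -> (forall y, 0 <= F y)%E ->
  (\int[leb k]_x F (tnorm x) =
   C * \int[@lebesgue_measure R]_u ((pos_expr k.-1 u)%:E * F u))%E.

(** The last [k.+1] variables enter only through their norm [r], so [C] times the weight [r ^+ k]
    replaces them, and the pair [(y, r)] is put in polar coordinates. *)
Lemma radial_const_polar (R : realType) (k : nat) (C : \bar R)
    (Q : R * R -> \bar R) :
    (0 <= C)%E -> radial_const k.+1 C ->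
    measurable_fun setT Q -> (forall p, 0 <= Q p)%E ->
  (\int[@lebesgue_measure R]_y \int[leb k.+1]_x
     Q (y / Num.sqrt (y ^+ 2 + tsq x), Num.sqrt (y ^+ 2 + tsq x))%R =
   C * \int[@lebesgue_measure R]_s
     ((Num.sqrt (1 + s ^+ 2) ^- k.+2)%:E *
      \int[@lebesgue_measure R]_u
        ((pos_expr k.+1 u)%:E * Q (s / Num.sqrt (1 + s ^+ 2), u)%R)))%E.
Proof.
move=> C0 CE mQ Q0; rewrite -ge0_integral_polar// -ge0_integralZl//; last 2 first.
- apply: (@measurable_fun_fubini_tonelli_F _ _ (measurableTypeR R)
    (measurableTypeR R) R lebesgue_measure
    (fun p => (pos_expr k p.2)%:E * Q (p.1 / Num.sqrt (p.1 ^+ 2 + p.2 ^+ 2),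
                             Num.sqrt (p.1 ^+ 2 + p.2 ^+ 2))%R)%E).
    apply: emeasurable_funM; first by apply/measurable_EFinP; mfun.
    by apply: (measurableT_comp mQ); mfun.
  by move=> p; rewrite mule_ge0// lee_fin pos_expr_ge0.
- by move=> y _; apply: integral_ge0 => r _; rewrite mule_ge0// lee_fin pos_expr_ge0.
apply: eq_integral => y _.
rewrite -(CE (fun r => Q (y / Num.sqrt (y ^+ 2 + r ^+ 2),
                          Num.sqrt (y ^+ 2 + r ^+ 2)))%R)//.
  by apply: eq_integral => x _; rewrite [tnorm x ^+ 2]sqr_sqrtr// tsq_ge0.
by apply: (measurableT_comp mQ); mfun.
Qed.

(** Each new dimension multiplies the constant by the integral of a power of [1 + s ^+ 2]. That
    integral is left unevaluated, since the Gaussian will determine the constant. *)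
Lemma radial_const_ex (R : realType) (k : nat) :
  exists2 C : \bar R, (0 <= C)%E & radial_const k.+1 C.
Proof.
elim: k => [|k [C C0 CE]].
  exists 2%:E => // F mF F0; rewrite -ge0_integral_norm1//.
  rewrite ge0_integral_leb_tcons//; last by apply: (measurableT_comp mF); mfun.
  apply: eq_integral => y _; rewrite ge0_integral_leb0//.
    rewrite /tnorm -/(tsq _) tsq_tcons /tsq big_ord0 addr0.
    by rewrite sqrtr_sqr.
  apply: (measurableT_comp mF); apply: (measurableT_comp (@measurable_tnorm R 1)).
  by apply: (measurableT_comp (@measurable_tcons R 0)); mfun.
have q0 (s : R) : (0 <= (Num.sqrt (1 + s ^+ 2) ^- k.+2)%:E)%E.
  by rewrite lee_fin invr_ge0 exprn_ge0.
exists (C * \int[@lebesgue_measure R]_s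
  (Num.sqrt (1 + s ^+ 2) ^- k.+2)%:E)%E.
  by rewrite mule_ge0//; apply: integral_ge0 => s _.
move=> F mF F0.
rewrite ge0_integral_leb_tcons//; last by apply: (measurableT_comp mF); mfun.
transitivity (\int[@lebesgue_measure R]_y \int[leb k.+1]_x
     F (Num.sqrt (y ^+ 2 + tsq x)))%E.
  by apply: eq_integral => y _; apply: eq_integral => x _; rewrite -tsq_tcons.
rewrite (radial_const_polar C0 CE (Q := F \o snd))//; last 2 first.
- by apply: (measurableT_comp mF); exact: measurable_snd.
- by move=> p; exact: F0.
rewrite -muleA; congr (_ * _)%E; rewrite /= ge0_integralZr//.
- by apply/measurable_EFinP; mfun.
- by apply: integral_ge0 => u _; rewrite mule_ge0// lee_fin pos_expr_ge0.
Qed.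

(** The Gaussian is a product over the coordinates as well as a radial function; comparing the two
    descriptions yields the radial constant. *)
Lemma integral_leb_gauss (R : realType) (k : nat) :
  (\int[leb k]_x (expR (- tsq x))%:E = (Num.sqrt (pi : R) ^+ k)%:E)%E.
Proof.
have mE j : measurable_fun setT (fun x : j.-tuple R => (expR (- tsq x))%:E).
  apply/measurable_EFinP; apply: (measurableT_comp (@measurable_expR R)).
  by apply: measurable_funN; mfun.
elim: k => [|k IH].
  by rewrite ge0_integral_leb0// /tsq big_ord0 oppr0 expR0 expr0.
rewrite ge0_integral_leb_tcons//.
transitivity (\int[@lebesgue_measure R]_y
    ((expR (- y ^+ 2))%:E * (Num.sqrt pi ^+ k)%:E))%E.
  apply: eq_integral => y _; rewrite -IH -ge0_integralZl//; last exact: mE.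
  by apply: eq_integral => x _; rewrite tsq_tcons opprD expRD EFinM.
have mg : measurable_fun setT (fun y : R => (expR (- y ^+ 2))%:E).
  by apply/measurable_EFinP; exact: measurable_gauss_fun.
rewrite (ge0_integralZr (@lebesgue_measure R) measurableT mg)//.
by rewrite [X in (X * _)%E]integralT_gauss -EFinM exprS.
Qed.

(* Both sides are [\int exp(x s - exp s) ds], with [s = ln t] and [s = 2 ln u]
   respectively. *)
Lemma integral_Gamma_half (R : realType) (k : nat) :
  (\int[@lebesgue_measure R]_(t in `]0%R, +oo[)
     (t `^ (k.+1%:R / 2 - 1) * expR (- t))%:E =
   2%:E * \int[@lebesgue_measure R]_u
     ((pos_expr k u)%:E * (expR (- u ^+ 2))%:E))%E.
Proof.
pose x : R := k.+1%:R / 2.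
pose G (s : R) : \bar R := (expR (x * s - expR s))%:E.
have mG : measurable_fun setT G.
  apply/measurable_EFinP; apply: (measurableT_comp (@measurable_expR R)).
  apply: measurable_funB; first by mfun.
  exact: measurable_expR.
have G0 y : (0 <= G y)%E by rewrite lee_fin expR_ge0.
have D0 (y : R) : (`]0, +oo[%classic : set R) y -> 0 < y.
  by rewrite /= in_itv/= andbT.
have D1 (y : R) : 0 < y -> (`]0, +oo[%classic : set R) y.
  by rewrite /= in_itv/= andbT.
transitivity (\int[@lebesgue_measure R]_s G s)%E.
  apply/esym; apply: eq_trans.
    apply: (@ge0_integral_substitution R `]0, +oo[ (@ln R) (fun t => t^-1) expR) => //.
    - exact: interval_is_interval.
    - by move=> s; apply: D1; exact: expR_gt0.
    - exact: expRK.
    - by move=> y /D0 y0; exact: is_derive1_ln.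
    - by move=> y /D0 y0; apply: inv_continuous; rewrite gt_eqF.
    - by move=> y /D0 y0; rewrite invr_gt0.
  apply/esym; apply: eq_integral => t /[!inE] /D0 t0.
    rewrite /G lnK// -EFinM expRD -mulrA mulrCA mulrC; congr (_%:E).
    rewrite /powR gt_eqF//; congr (_ * _); rewrite mulrBl mul1r expRD.
    by rewrite expRN lnK.
apply: eq_trans.
  apply: (@ge0_integral_substitution R `]0, +oo[ (fun u => 2 * ln u)
    (fun u => 2 * u^-1) (fun s => expR (s / 2))) => //.
  - exact: interval_is_interval.
  - by move=> s; apply: D1; exact: expR_gt0.
  - by move=> s; rewrite expRK mulrCA divff ?mulr1// pnatr_eq0.
  - move=> y /D0 y0; apply: is_deriveZ; exact: is_derive1_ln.
  - move=> y /D0 y0; apply: cvgM; first exact: cvg_cst.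
    by apply: inv_continuous; rewrite gt_eqF.
  - by move=> y /D0 y0; rewrite mulr_gt0// invr_gt0.
rewrite -ge0_integralZl//; last 2 first.
+ apply: emeasurable_funM; apply/measurable_EFinP; first by mfun.
  apply: (measurableT_comp (@measurable_expR R)); apply: measurable_funN.
  exact: measurable_funX.
+ by move=> u _; rewrite mule_ge0// lee_fin ?pos_expr_ge0// expR_ge0.
rewrite [LHS]integral_mkcond; apply: eq_integral => u _; rewrite patchE.
case: ifPn => [/[!inE] /D0 u0|]; last first.
  rewrite notin_setE => /= /negP; rewrite in_itv/= andbT => /negbTE u0.
  by rewrite /pos_expr u0 mulr0 mul0e mule0.
rewrite /G -!EFinM; congr (_%:E); rewrite /pos_expr u0 mulr1.
have -> : x * (2 * ln u) = k.+1%:R * ln u by rewrite /x mulrA divfK// pnatr_eq0.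
rewrite expRD expRM_natl lnK// (mulr_natl (ln u)) -[_ *+ 2]mulr_natl expRM_natl lnK//.
by rewrite exprS; field; rewrite gt_eqF.
Qed.

(** Testing the radial formula on the Gaussian gives [C * J = Num.sqrt pi ^+ k.+1], where [2 * J] is
    the Gamma value; this identifies [C] and shows that the Gamma value is positive. *)
Lemma radial_const_area (R : realType) (k : nat) :
  radial_const k.+1 (@sphere_area R k.+1)%:E /\ 0 < euler_Gamma (k.+1%:R / 2 : R).
Proof.
have [C C0 CE] := @radial_const_ex R k.
pose J := (\int[@lebesgue_measure R]_u
  ((pos_expr k u)%:E * (expR (- u ^+ 2))%:E))%E.
have J0 : (0 <= J)%E.
  by apply: integral_ge0 => u _; rewrite mule_ge0// lee_fin ?pos_expr_ge0// expR_ge0.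
have CJ : (C * J = (Num.sqrt pi ^+ k.+1)%:E)%E.
  rewrite -integral_leb_gauss -(CE (fun u => (expR (- u ^+ 2))%:E)).
  - by apply: eq_integral => x _; rewrite sqr_sqrtr// tsq_ge0.
  - apply/measurable_EFinP; exact: measurable_gauss_fun.
  - by move=> y; rewrite lee_fin expR_ge0.
have p0 : 0 < Num.sqrt (pi : R) ^+ k.+1 by rewrite exprn_gt0// sqrtr_gt0 pi_gt0.
(* Nonnegative extended reals whose product is a positive real are finite and positive: 0 times
   infinity is 0, and any other infinite factor makes the product infinite. *)
have [c [j [c0 j0 CEc JEj]]] : exists c j, [/\ 0 < c, 0 < j, C = c%:E & J = j%:E].
  move: C0 J0 CJ; clear -p0; move: J => J.
  case: C => [c| |] //; case: J => [j| |] //.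
  - rewrite !lee_fin => c0 j0 [cj]; exists c, j; split => //.
      rewrite lt_neqAle c0 andbT; apply/eqP => c1; move: cj p0.
      by rewrite -c1 mul0r => <-; rewrite ltxx.
    rewrite lt_neqAle j0 andbT; apply/eqP => j1; move: cj p0.
    by rewrite -j1 mulr0 => <-; rewrite ltxx.
  - rewrite le_eqVlt => /predU1P[<- _|c0 _]; last by rewrite gt0_muley.
    by rewrite mul0e => -[e]; move: p0; rewrite -e ltxx.
  - move=> _; rewrite le_eqVlt => /predU1P[<-|c0]; last by rewrite gt0_mulye.
    by rewrite mule0 => -[e]; move: p0; rewrite -e ltxx.
have GE : euler_Gamma (k.+1%:R / 2 : R) = 2 * j.
  by rewrite /euler_Gamma /Rintegral integral_Gamma_half -/J JEj.
have G0 : 0 < euler_Gamma (k.+1%:R / 2 : R) by rewrite GE mulr_gt0.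
split => //; suff -> : @sphere_area R k.+1 = c by rewrite -CEc.
rewrite /sphere_area GE.
have -> : (pi : R) `^ (k.+1%:R / 2) = c * j.
  have : (c * j)%:E = (Num.sqrt (pi : R) ^+ k.+1)%:E by rewrite EFinM -CEc -JEj.
  move=> [->]; rewrite -powR12_sqrt ?pi_ge0// -powR_mulrn ?powR_ge0//.
  by rewrite -powRrM mulrC.
by field; rewrite gt_eqF.
Qed.

(** * The law of a coordinate on the sphere *)

Lemma tnorm_tnormalize (R : realType) k (x : k.-tuple R) :
  0 < tnorm x -> tnorm (tnormalize x) = 1.
Proof.
move=> x0; rewrite {1}/tnorm; under eq_bigr do rewrite tnth_mktuple exprMn exprVn.
rewrite -mulr_suml -[X in X / _]/(tsq x) -[X in X / _]sqr_sqrtr ?tsq_ge0//.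
by rewrite divff ?sqrtr1// expf_neq0// gt_eqF.
Qed.

Lemma tdot_tnormalize (R : realType) k (w x : k.-tuple R) :
  tdot w (tnormalize x) = tdot w x / tnorm x.
Proof.
by rewrite /tdot mulr_suml; apply: eq_bigr => i _; rewrite tnth_mktuple mulrA.
Qed.

Definition unit_ball_indic (R : realType) (u : R) : R := (0 < u <= 1)%R%:R.

Lemma unit_ball_indicE (R : realType) :
  @unit_ball_indic R = \1_(`]0, 1]%classic).
Proof.
apply/funext => r; rewrite /unit_ball_indic indicE; congr (_%:R).
by rewrite mem_setE in_itv.
Qed.

Lemma measurable_unit_ball_indic (R : realType) :
  measurable_fun setT (@unit_ball_indic R).
Proof. by rewrite unit_ball_indicE; exact: measurable_indic. Qed.

(** On sets this is the definition by cones: the surface measure is the image under normalization of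
    [k] times Lebesgue measure on the punctured unit ball. *)
Lemma ge0_integral_sphere_measure (R : realType) (k : nat)
    (f : k.-tuple R -> \bar R) :
    measurable_fun setT f -> (forall x, 0 <= f x)%E ->
  (\int[@sphere_measure R k]_x f x =
   \int[leb k]_x (f (tnormalize x) * (k%:R * unit_ball_indic (tnorm x))%:E))%E.
Proof.
move=> mf f0.
have mi : measurable_fun setT (fun x : k.-tuple R => unit_ball_indic (tnorm x)).
  by apply: (measurableT_comp (@measurable_unit_ball_indic R)); mfun.
have i0 (x : k.-tuple R) : 0 <= unit_ball_indic (tnorm x) by exact: ler0n.
have mw : measurable_fun setT (fun x : k.-tuple R => k%:R * unit_ball_indic (tnorm x)).
  exact: measurable_funM.
have w0 (x : k.-tuple R) : 0 <= k%:R * unit_ball_indic (tnorm x) by rewrite mulr_ge0.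
have [nu nuE <-//] := ge0_density_pushforward (leb k) (@measurable_tnormalize R k) mw w0.
apply: eq_measure_integral => A mA _; rewrite nuE//.
have mB : measurable (@tnormalize R k @^-1` A).
  by rewrite -[X in measurable X]setTI; exact: measurable_tnormalize.
under eq_integral do rewrite EFinM.
rewrite ge0_integralZl//; last 2 first.
- by apply: measurable_funTS; apply/measurable_EFinP.
- by move=> x _; rewrite lee_fin.
congr (_ * _)%E; rewrite unit_ball_indicE.
have mC : measurable (@tnorm R k @^-1` `]0, 1]).
  by rewrite -[X in measurable X]setTI; exact: measurable_tnorm.
rewrite -[LHS]/(leb k (cone A)) -[RHS]/(\int[leb k]_(x in _)
   (\1_(@tnorm R k @^-1` `]0, 1]) x)%:E)%E integral_indic//.
Qed.

(** This is why [sphere_measure] carries its dimension factor: it cancels the radial integral over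
    the cone. *)
Lemma integral_pos_expr_unit (R : realType) (k : nat) :
  (\int[@lebesgue_measure R]_u
     (pos_expr k u * (k.+1%:R * unit_ball_indic u))%:E = 1)%E.
Proof.
transitivity (\int[@lebesgue_measure R]_(u in `]0%R, 1%R]) (k.+1%:R * u ^+ k)%:E)%E.
  rewrite [RHS]integral_mkcond; apply: eq_integral => u _.
  rewrite patchE mem_setE in_itv/= /pos_expr /unit_ball_indic.
  case: (ltP 0 u) => /= u0; last by rewrite mulr0 mul0r.
  by case: ifP => _; rewrite !(mulr1, mulr0)// mulrC.
rewrite integral_itv_obnd_cbnd; last first.
  by apply/measurable_EFinP; apply: measurable_funTS; mfun.
rewrite (@continuous_FTC2 R _ (fun u => u ^+ k.+1))//.
- by rewrite expr1n expr0n/= sube0.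
- apply: continuous_subspaceT => u; apply: cvgM; first exact: cvg_cst.
  exact: exprn_continuous.
- split.
  + by move=> u _; exact: exprn_derivable.
  + by apply: cvg_at_right_filter; exact: exprn_continuous.
  + by apply: cvg_at_left_filter; exact: exprn_continuous.
- move=> u _; rewrite exp_derive1 -mulr_natl /=.
  by rewrite mulr1.
Qed.

(** Normalization divides the coordinate along [w] by the norm, so the integrand depends on
    [tdot w x] and [tsq x] only; once the norm is integrated out, the slope [s] remains. *)
Lemma ge0_integral_sphere_polar (R : realType) (k : nat) (w : k.+2.-tuple R)
    (h : R -> \bar R) :
    tsq w = 1 -> measurable_fun setT h -> (forall t, 0 <= h t)%E ->
  (\int[@sphere_measure R k.+2]_(x in [set x | tnorm x = 1%R]) h (tdot w x) =
   (@sphere_area R k.+1)%:E * \int[@lebesgue_measure R]_s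
     ((Num.sqrt (1 + s ^+ 2) ^- k.+2)%:E * h (s / Num.sqrt (1 + s ^+ 2))%R))%E.
Proof.
move=> w1 mh h0.
have [CE G0] := radial_const_area R k.
have C0 : 0 <= @sphere_area R k.+1.
  by rewrite /sphere_area divr_ge0 ?mulr_ge0 ?powR_ge0// ltW.
have mS : measurable [set x : k.+2.-tuple R | tnorm x = 1].
  rewrite (_ : mkset _ = @tnorm R k.+2 @^-1` [set 1])//.
  by rewrite -[X in measurable X]setTI; apply: measurable_tnorm => //; exact: measurable_set1.
have mhw : measurable_fun setT (fun x : k.+2.-tuple R => h (tdot w x)).
  by apply: (measurableT_comp mh); mfun.
rewrite integral_mkcond ge0_integral_sphere_measure; last 2 first.
- by apply/(measurable_restrictT _ mS); exact: measurable_funTS.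
- by move=> x; rewrite patchE; case: ifPn.
pose Q (p : R * R) := (h p.1 * (k.+2%:R * unit_ball_indic p.2)%:E)%E.
have mQ : measurable_fun setT Q.
  apply: emeasurable_funM; first by apply: (measurableT_comp mh); mfun.
  apply/measurable_EFinP; apply: measurable_funM => //.
  by apply: (measurableT_comp (@measurable_unit_ball_indic R)); mfun.
have Q0 p : (0 <= Q p)%E by rewrite mule_ge0// lee_fin mulr_ge0// ler0n.
pose G (p : R * R) := Q (p.1 / Num.sqrt p.2, Num.sqrt p.2).
have mG : measurable_fun setT G by apply: (measurableT_comp mQ); mfun.
transitivity (\int[leb k.+2]_x G (tdot w x, tsq x))%E.
  apply: eq_integral => x _; rewrite /G /Q /= -[Num.sqrt (tsq x)]/(tnorm x).
  have [x0|x0] := ltP 0 (tnorm x); last first.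
    by rewrite /unit_ball_indic ltNge x0/= mulr0 !mule0.
  rewrite patchE ifT ?tdot_tnormalize//.
  by rewrite inE /= tnorm_tnormalize.
rewrite ge0_integral_leb_proj//; last by move=> p; exact: Q0.
have C0E : (0 <= (@sphere_area R k.+1)%:E)%E by rewrite lee_fin.
apply: (eq_trans (radial_const_polar C0E CE mQ Q0)); congr (_ * _)%E.
apply: eq_integral => s _; congr (_ * _)%E.
rewrite /Q /=; under eq_integral do rewrite muleCA -EFinM.
rewrite ge0_integralZl//.
- by rewrite integral_pos_expr_unit mule1.
- apply/measurable_EFinP; apply: measurable_funM; first by mfun.
  by apply: measurable_funM => //; exact: measurable_unit_ball_indic.
- by move=> u _; rewrite lee_fin mulr_ge0 ?pos_expr_ge0// mulr_ge0// ler0n.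
Qed.

(** Here [t] is the sine of the angle with slope [s]: [1 + s ^+ 2] is the inverse of [1 - t ^+ 2]
    and the Jacobian is [1 - t ^+ 2] to the power -3/2, whence the exponent [(k%:R - 3) / 2]. *)
Lemma ge0_integral_slope_sine (R : realType) (k : nat) (h : R -> \bar R) :
    measurable_fun setT h -> (forall t, 0 <= h t)%E ->
  (\int[@lebesgue_measure R]_s
     ((Num.sqrt (1 + s ^+ 2) ^- k)%:E * h (s / Num.sqrt (1 + s ^+ 2))%R) =
   \int[@lebesgue_measure R]_(t in `](-1)%R, 1%R[)
     (h t * ((1 - t ^+ 2) `^ ((k%:R - 3) / 2))%:E))%E.
Proof.
move=> mh h0.
have D1 (t : R) : (`]-1, 1[%classic : set R) t -> 0 < 1 - t ^+ 2.
  rewrite /= in_itv/= => /andP[t1 t2]; rewrite -[1](expr1n _ 2) subr_sqr.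
  by rewrite mulr_gt0 ?subr_gt0// -ltrBlDl sub0r.
have DE (t : R) : 0 < 1 - t ^+ 2 -> (`]-1, 1[%classic : set R) t.
  move=> t1; rewrite /= in_itv/= -ltr_norml -(@ltr_pXn2r _ 2) ?nnegrE//.
  by rewrite real_normK ?num_real// expr1n -subr_gt0.
have s0 (s : R) : 0 < 1 + s ^+ 2 by rewrite ltr_wpDr// sqr_ge0.
have sE (s : R) : 1 - (s / Num.sqrt (1 + s ^+ 2)) ^+ 2 = (1 + s ^+ 2)^-1.
  rewrite exprMn exprVn sqr_sqrtr ?ltW//.
  by field; rewrite gt_eqF.
apply: eq_trans.
  apply: (@ge0_integral_substitution R `]-1, 1[
    (fun t => t * (Num.sqrt (1 - t ^+ 2))^-1)
    (fun t => Num.sqrt (1 - t ^+ 2) ^- 3)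
    (fun s => s / Num.sqrt (1 + s ^+ 2))) => //.
  - exact: interval_is_interval.
  - by move=> s; apply: DE; rewrite sE invr_gt0 s0.
  - move=> s; rewrite sE sqrtrV ?ltW// invrK divfK//.
    by rewrite gt_eqF// sqrtr_gt0.
  - move=> t /D1 t0; have p0 : 0 < Num.sqrt (1 - t ^+ 2) by rewrite sqrtr_gt0.
    have p2 : Num.sqrt (1 - t ^+ 2) ^+ 2 = 1 - t ^+ 2 by rewrite sqr_sqrtr// ltW.
    have dy : is_derive t (1 : R) (fun t => 1 - t ^+ 2) (- (2 * t)).
      by apply: is_derive_eq; rewrite add0r mul1r -mulr2n [_%:A]mulr1 mulr_natl.
    have ds : is_derive t (1 : R) (fun t => Num.sqrt (1 - t ^+ 2))
        (- t / Num.sqrt (1 - t ^+ 2)).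
      apply: (is_derive_eq (@is_derive1_comp R (@Num.sqrt R) (fun t => 1 - t ^+ 2)
        t _ _ (is_derive1_sqrt t0) dy)).
      by field; rewrite gt_eqF.
    have di := @is_deriveV R (fun t => Num.sqrt (1 - t ^+ 2)) t _ 1 (lt0r_neq0 p0) ds.
    apply: (is_derive_eq (@is_deriveM R R (fun t => t)
      (fun t => (Num.sqrt (1 - t ^+ 2))^-1) t 1 _ _ (is_derive_id _ _) di)).
    move: p0 p2; set p := Num.sqrt _ => p0 p2.
    transitivity ((t ^+ 2 + p ^+ 2) / p ^+ 3); last by rewrite p2 addrC subrK mul1r.
    rewrite [_ *: 1]mulr1 [_ *: (_ *: _)]mulrA /=.
    by field; rewrite gt_eqF.
  - move=> t /D1 t0.
    apply: cvgV; first by rewrite expf_neq0// gt_eqF// sqrtr_gt0.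
    apply: (cvg_comp (fun t => Num.sqrt (1 - t ^+ 2)) (fun x => x ^+ 3));
      last exact: exprn_continuous.
    apply: (cvg_comp (fun t => 1 - t ^+ 2) (@Num.sqrt R));
      last exact: sqrt_continuous.
    by apply: cvgB; [exact: cvg_cst|exact: exprn_continuous].
  - by move=> t /D1 t0; rewrite invr_gt0 exprn_gt0// sqrtr_gt0.
  - apply: emeasurable_funM; first by apply/measurable_EFinP; mfun.
    by apply: (measurableT_comp mh); mfun.
  - by move=> y; rewrite mule_ge0// lee_fin invr_ge0 exprn_ge0// sqrtr_ge0.
apply: eq_integral => t /[!inE] /D1 t0.
set p := Num.sqrt (1 - t ^+ 2).
have p0 : 0 < p by rewrite sqrtr_gt0.
have p2 : p ^+ 2 = 1 - t ^+ 2 by rewrite sqr_sqrtr// ltW.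
have -> : Num.sqrt (1 + (t * p^-1) ^+ 2) = p^-1.
  rewrite (_ : 1 + _ = p^-1 ^+ 2) ?sqrtr_sqr ?gtr0_norm ?invr_gt0//.
  rewrite exprMn exprVn; apply: (mulIf (expf_neq0 2 (lt0r_neq0 p0))).
  by rewrite mulrDl mul1r divfK ?mulVf ?expf_neq0 ?lt0r_neq0// p2 subrK.
rewrite invrK divfK ?lt0r_neq0// exprVn invrK muleAC -EFinM muleC.
congr (_ * _%:E)%E.
rewrite -p2 -(@powR_mulrn _ p 2) ?ltW// -powRrM mulrCA divff ?mulr1 ?pnatr_eq0//.
rewrite powRB; last by rewrite (gt_eqF p0) implybT.
by rewrite !powR_mulrn ?ltW.
Qed.

(* When [x = y = +oo] both sides are [-oo], the junk value of [+oo - +oo]. *)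
Lemma muleBr_gt0 (R : realDomainType) (c : R) (x y : \bar R) :
    0 < c -> (0 <= x)%E -> (0 <= y)%E ->
  (c%:E * (x - y) = c%:E * x - c%:E * y)%E.
Proof.
move=> c0; have c0E : (0 < c%:E)%E by rewrite lte_fin.
case: x => [x| |] // x0; case: y => [y| |] // y0.
- by rewrite -EFinB -!EFinM -EFinB mulrBr.
- by rewrite /= gt0_muley// gt0_muleNy.
- by rewrite /= gt0_muley.
- by rewrite /= gt0_muley// gt0_muleNy.
Qed.

Lemma sphere_area_gt0 (R : realType) (k : nat) : 0 < @sphere_area R k.+1.
Proof.
have [_ G0] := radial_const_area R k.
by rewrite /sphere_area divr_gt0// mulr_gt0// powR_gt0// pi_gt0.
Qed.

(** With [s = A + B * t], the factor [1 - t ^+ 2] becomes [(s - (A - B)) * (A + B - s) / B ^+ 2];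
    its powers of [B] and the Jacobian combine to the exponent [2 - k.+2%:R]. *)
Lemma ge0_integral_sphere_affine (R : realType) (k : nat) (w : k.+2.-tuple R)
    (A B : R) (g : R -> \bar R) :
    tsq w = 1 -> 0 < B -> measurable_fun setT g -> (forall t, 0 <= g t)%E ->
  (\int[@sphere_measure R k.+2]_(x in [set x | tnorm x = 1%R])
      g (A + B * tdot w x)%R =
   (@sphere_area R k.+1 * B `^ (2 - k.+2%:R))%:E *
   \int[@lebesgue_measure R]_(s in `](A - B)%R, (A + B)%R[)
     (g s * (((s - (A - B)) * (A + B - s)) `^ ((k.+2%:R - 3) / 2))%:E))%E.
Proof.
move=> w1 B0 mg g0; set p := (k.+2%:R - 3) / 2.
have mgA : measurable_fun setT (fun t : R => g (A + B * t)).
  by apply: (measurableT_comp mg); mfun.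
have gA0 t : (0 <= g (A + B * t)%R)%E by exact: g0.
apply: (eq_trans (ge0_integral_sphere_polar w1 mgA gA0)).
move: (@sphere_area R k.+1) => sigma.
apply: (eq_trans (congr1 (fun z => sigma%:E * z)%E
  (ge0_integral_slope_sine k.+2 mgA gA0))).
rewrite [(sigma * _)%:E]EFinM -muleA; congr (_ * _)%E.
pose K (s : R) := (g s * (((s - (A - B)) * (A + B - s)) `^ p)%:E)%E.
have mK : measurable_fun setT K.
  apply: emeasurable_funM => //; apply/measurable_EFinP.
  by apply: (measurableT_comp (measurable_powR p)); mfun.
have K0 s : (0 <= K s)%E by rewrite mule_ge0// lee_fin powR_ge0.
have mI : measurable (`]A - B, A + B[%classic : set R) by [].
rewrite [LHS]integral_mkcond [X in (_ * X)%E]integral_mkcond.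
pose K' : R -> \bar R := K \_ `]A - B, A + B[.
rewrite -/K'.
have mK' : measurable_fun setT K'.
  by apply/(measurable_restrictT _ mI); exact: measurable_funTS.
have K'0 s : (0 <= K' s)%E by rewrite /K' patchE; case: ifPn.
have -> : (\int[@lebesgue_measure R]_x K' x =
    B%:E * \int[@lebesgue_measure R]_t K' (B * t + A)%R)%E.
  by rewrite ge0_integral_affine// muleA -EFinM divff ?gt_eqF// mul1e.
rewrite muleA -EFinM -ge0_integralZl//; last 2 first.
- by apply: (measurableT_comp mK'); mfun.
- by rewrite lee_fin mulr_ge0// ?powR_ge0// ltW.
apply: eq_integral => t _; rewrite /K' !patchE.
have -> : (B * t + A \in (`]A - B, A + B[%classic : set R)) =
    (t \in (`]-1, 1[%classic : set R)).
  rewrite !mem_setE !in_itv/= [B * t + A]addrC !ltrD2l -(mulrN1 B).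
  by rewrite -[X in B * t < X](mulr1 B) !ltr_pM2l.
case: ifPn => [|_]; last by rewrite mule0.
rewrite inE /= in_itv/= => /andP[t1 t2].
rewrite /K addrC muleCA -EFinM; congr (_ * _%:E)%E.
have -> : (B * t + A - (A - B)) * (A + B - (B * t + A)) = B ^+ 2 * (1 - t ^+ 2).
  by ring.
have t3 : 0 <= 1 - t ^+ 2.
  by rewrite -[1](expr1n _ 2) subr_sqr mulr_ge0// ?subr_ge0 ltW// -ltrBlDl sub0r.
rewrite powRM ?sqr_ge0// -(@powR_mulrn _ B 2) ?ltW// -powRrM -/p.
rewrite mulrA -[LHS]mul1r; congr (_ * _).
rewrite -{2}(powRr1 (ltW B0)) -!powRD ?(gt_eqF B0) ?implybT//.
rewrite (_ : _ + _ + _ = 0) ?powRr0//.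
by rewrite /p; field.
Qed.

(* The positive and negative parts are treated separately, so that the identity
   also holds for divergent integrals. *)
Lemma integral_sphere_affine (R : realType) (k : nat) (w : k.+2.-tuple R)
    (A B : R) (g : R -> R) :
    tsq w = 1 -> 0 < B -> measurable_fun setT g ->
  (\int[@sphere_measure R k.+2]_(x in [set x | tnorm x = 1%R])
      (g (A + B * tdot w x)%R)%:E =
   (@sphere_area R k.+1 * B `^ (2 - k.+2%:R))%:E *
   \int[@lebesgue_measure R]_(s in `](A - B)%R, (A + B)%R[)
     (g s * ((s - (A - B)) * (A + B - s)) `^ ((k.+2%:R - 3) / 2))%:E)%E.
Proof.
move=> w1 B0 mg.
have mgE : measurable_fun setT (EFin \o g) by exact/measurable_EFinP.
rewrite [LHS]integralE [X in (_ * X)%E]integralE muleBr_gt0; last 3 first.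
- by rewrite mulr_gt0 ?sphere_area_gt0 ?powR_gt0.
- exact: integral_ge0.
- exact: integral_ge0.
have [sgnp sgnn] : (forall a b : R, 0 <= b ->
    maxe (a * b)%:E 0 = (maxe a%:E 0 * b%:E)%E) /\ (forall a b : R, 0 <= b ->
    maxe (- (a * b)%:E)%E 0 = (maxe (- a%:E) 0 * b%:E)%E).
  by split=> a b b0; rewrite maxe_pMl// ?mulNe mul0e.
congr (_ - _)%E.
- have := ge0_integral_sphere_affine A w1 B0 (measurable_funepos mgE)
    (funepos_ge0 _).
  under eq_integral do rewrite funeposE.
  under [in X in _ = X -> _]eq_integral do rewrite funeposE.
  under [in LHS]eq_integral do rewrite funeposE.
  move=> ->; congr (_ * _)%E; apply: eq_integral => s _.
  by rewrite funeposE sgnp// powR_ge0.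
- have := ge0_integral_sphere_affine A w1 B0 (measurable_funeneg mgE)
    (funeneg_ge0 _).
  under eq_integral do rewrite funenegE.
  under [in X in _ = X -> _]eq_integral do rewrite funenegE.
  under [in LHS]eq_integral do rewrite funenegE.
  move=> ->; congr (_ * _)%E; apply: eq_integral => s _.
  by rewrite funenegE sgnn// powR_ge0.
Qed.

(** * Spherical geometry *)

Section dot_theory.
Context {R : realType} {n : nat}.
Implicit Types (x y z : 'rV[R]_n) (a : R) (U : {vspace 'rV[R]_n}).

Lemma dotC x y : dot x y = dot y x.
Proof. by apply: eq_bigr => i _; rewrite mulrC. Qed.

Lemma dotDl x y z : dot (x + y) z = dot x z + dot y z.
Proof. by rewrite -big_split; apply: eq_bigr => i _; rewrite mxE mulrDl. Qed.

Lemma dotZl a x y : dot (a *: x) y = a * dot x y.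
Proof. by rewrite mulr_sumr; apply: eq_bigr => i _; rewrite mxE mulrA. Qed.

Lemma dotNl x y : dot (- x) y = - dot x y.
Proof. by rewrite -scaleN1r dotZl mulN1r. Qed.

Lemma dotBl x y z : dot (x - y) z = dot x z - dot y z.
Proof. by rewrite dotDl dotNl. Qed.

Lemma dotDr x y z : dot x (y + z) = dot x y + dot x z.
Proof. by rewrite dotC dotDl !(dotC x). Qed.

Lemma dotZr a x y : dot x (a *: y) = a * dot x y.
Proof. by rewrite dotC dotZl dotC. Qed.

Lemma dotNr x y : dot x (- y) = - dot x y.
Proof. by rewrite dotC dotNl dotC. Qed.

Lemma dotBr x y z : dot x (y - z) = dot x y - dot x z.
Proof. by rewrite dotDr dotNr. Qed.

Lemma dot0l x : dot 0 x = 0.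
Proof. by rewrite -(scale0r 0) dotZl mul0r. Qed.

Lemma dot_suml (I : finType) (F : I -> 'rV[R]_n) x :
  dot (\sum_i F i) x = \sum_i dot (F i) x.
Proof. exact: (big_morph (fun u => dot u x) (fun u v => dotDl u v x) (dot0l x)). Qed.

Lemma dot_ge0 x : 0 <= dot x x.
Proof. by apply: sumr_ge0 => i _; rewrite -expr2 sqr_ge0. Qed.

Lemma dot_eq0 x : (dot x x == 0) = (x == 0).
Proof.
apply/idP/eqP => [|->]; last by rewrite dot0l.
rewrite psumr_eq0; last by move=> i _; rewrite -expr2 sqr_ge0.
move=> /allP x0; apply/rowP => i; rewrite mxE.
by have := x0 i (mem_index_enum _); rewrite -expr2 sqrf_eq0 => /eqP.
Qed.

(** Expands the squared norm of [b *: x - a *: y]. The norms are passed as [a] and [b] because in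
    the distance estimate they are sines, so no square root arises. *)
Lemma cauchy_schwarz x y (a b : R) : 0 <= a -> 0 <= b ->
  dot x x = a ^+ 2 -> dot y y = b ^+ 2 -> dot x y <= a * b.
Proof.
rewrite !le_eqVlt => /predU1P[<- b0|a0 /predU1P[<-|b0]] xx yy.
- have /eqP -> : x == 0 by rewrite -dot_eq0 xx expr0n.
  by rewrite dot0l mul0r eqxx.
- have /eqP -> : y == 0 by rewrite -dot_eq0 yy expr0n.
  by rewrite dotC dot0l mulr0 eqxx.
rewrite -le_eqVlt.
have E : dot (b *: x - a *: y) (b *: x - a *: y) =
    2 * (a * b) * (a * b - dot x y).
  by rewrite !(dotBl, dotBr, dotZl, dotZr) xx yy (dotC y x); ring.
have := dot_ge0 (b *: x - a *: y); rewrite E.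
by rewrite pmulr_rge0 ?subr_ge0// mulr_gt0// mulr_gt0.
Qed.

Lemma orthonormal_free k (X : k.-tuple 'rV[R]_n) :
  (forall i j : 'I_k, dot (tnth X i) (tnth X j) = (i == j)%:R) -> free X.
Proof.
move=> oX; apply/freeP => c c0 i.
have := dot0l (tnth X i); rewrite -c0 dot_suml (bigD1 i)//= big1 ?addr0.
  by rewrite dotZl -tnth_nth oX eqxx mulr1.
by move=> j ji; rewrite dotZl -tnth_nth oX (negbTE ji) mulr0.
Qed.

(** Gram-Schmidt: by dimension some vector of [U] lies outside the span of the family so far, and
    what remains of it after removing its projections is normalized. *)
Lemma orthonormal_family U k : (k <= \dim U)%N ->
  exists X : k.-tuple 'rV[R]_n, {subset X <= U} /\
    forall i j : 'I_k, dot (tnth X i) (tnth X j) = (i == j)%:R.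
Proof.
elim: k => [_|k IH kU]; first by exists [tuple]; split => [x|[]].
have [X [XU oX]] := IH (ltnW kU).
have /subvPn[v vU vX] : ~~ (U <= <<X>>)%VS.
  apply/negP => /dimvS; rewrite leqNgt => /negP; apply.
  by rewrite (leq_ltn_trans (dim_span _))// size_tuple.
pose u := v - \sum_i dot v (tnth X i) *: tnth X i.
have XUt i : tnth X i \in U by apply: XU; exact: mem_tnth.
have uU : u \in U.
  by apply: rpredB => //; apply: rpred_sum => i _; exact: rpredZ.
have u0 : u != 0.
  apply: contra vX; rewrite subr_eq0 => /eqP ->; apply: rpred_sum => i _.
  by apply: rpredZ; apply: memv_span; exact: mem_tnth.
have uX i : dot u (tnth X i) = 0.
  rewrite dotBl dot_suml (bigD1 i)//= big1 ?addr0.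
    by rewrite dotZl oX eqxx mulr1 subrr.
  by move=> j ji; rewrite dotZl oX (negbTE ji) mulr0.
have uu : 0 < dot u u by rewrite lt_neqAle eq_sym dot_eq0 u0 dot_ge0.
pose e := (Num.sqrt (dot u u))^-1 *: u.
have ee : dot e e = 1.
  rewrite dotZl dotZr mulrA -invfM -expr2 sqr_sqrtr ?dot_ge0//.
  by rewrite mulVf// gt_eqF.
have eX i : dot e (tnth X i) = 0 by rewrite dotZl uX mulr0.
exists [tuple of e :: X]; split.
  move=> x; rewrite inE => /predU1P[->|/XU//]; exact: rpredZ.
move=> i j; case: (unliftP ord0 i) => [i'|] ->; case: (unliftP ord0 j) => [j'|] ->.
- by rewrite !tnthS oX (inj_eq lift_inj).
- by rewrite tnthS tnth0 dotC eX eq_sym.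
- by rewrite tnthS tnth0 eX.
- by rewrite !tnth0 ee eqxx.
Qed.

Lemma orthobasisP k U : \dim U = k -> is_orthobasis U (orthobasis k U).
Proof.
move=> dU; rewrite /orthobasis; case: xgetP => [X _ //|noX].
have [X [XU oX]] := @orthonormal_family U k (eq_leq (esym dU)).
exfalso; apply: (noX X); split => //; rewrite basisEfree orthonormal_free//=.
by rewrite size_tuple dU leqnn andbT; apply/span_subvP.
Qed.

Lemma orthobasis_sum k U (x : k.-tuple R) (X : k.-tuple 'rV[R]_n) :
    is_orthobasis U X ->
  \sum_(i < k) tnth x i *: tnth X i \in U /\
  dot (\sum_(i < k) tnth x i *: tnth X i) (\sum_(i < k) tnth x i *: tnth X i)
    = tsq x.
Proof.
move=> [/andP[/eqP sU fX] oX]; split.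
  apply: rpred_sum => i _; apply: rpredZ; rewrite -sU.
  by apply: memv_span; exact: mem_tnth.
rewrite dot_suml; apply: eq_bigr => i _; rewrite dotZl dotC dot_suml.
rewrite (bigD1 i)//= big1 ?addr0; first by rewrite dotZl oX eqxx mulr1 expr2.
by move=> j ji; rewrite dotZl oX (negbTE ji) mulr0.
Qed.

(** Parseval's identity; it turns a unit vector of the subspace into the unit vector of R^k along
    which the law of a coordinate is applied. *)
Lemma orthobasis_expand k U (z : 'rV[R]_n) (X : k.-tuple 'rV[R]_n) :
  is_orthobasis U X -> z \in U ->
  tsq [tuple dot (tnth X i) z | i < k] = dot z z.
Proof.
move=> obX zU; have [bX oX] := obX.
pose c := [tuple coord X i z | i < k].
have zE : z = \sum_(i < k) tnth c i *: tnth X i.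
  rewrite {1}(coord_basis bX zU); apply: eq_bigr => i _.
  by rewrite tnth_mktuple -tnth_nth.
rewrite [RHS](_ : _ = tsq c); last by rewrite zE; exact: (orthobasis_sum c obX).2.
apply: eq_bigr => i _; rewrite tnth_mktuple; congr (_ ^+ 2).
rewrite zE dotC dot_suml (bigD1 i)//= big1 ?addr0.
  by rewrite dotZl oX eqxx mulr1.
by move=> j ji; rewrite dotZl oX (negbTE ji) mulr0.
Qed.

End dot_theory.

Section sphere_geometry.
Context {R : realType} {n : nat}.
Implicit Types (x y theta eta : 'rV[R]_n) (xi : {vspace 'rV[R]_n}).

Lemma sphere_npole : (0 < n)%N -> sphere (npole : 'rV[R]_n).
Proof.
case: n => // m _; rewrite /sphere /= /dot (bigD1 ord_max)//= big1 ?addr0.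
  by rewrite !mxE eqxx mulr1.
move=> i im; rewrite !mxE eqSS.
by rewrite (_ : (i == m :> nat) = false) ?mul0r//; apply/negbTE.
Qed.

Lemma sphere_dot_bound x y : sphere x -> sphere y -> -1 <= dot x y <= 1.
Proof.
rewrite /sphere /= => xx yy.
have h u v : dot u u = 1 -> dot v v = 1 -> dot (u : 'rV[R]_n) v <= 1.
  by move=> uu vv; rewrite -[1]mulr1 cauchy_schwarz// ?expr1n.
rewrite h// andbT -[-1]opprK lerNl opprK -dotNl h// ?dotNl ?dotNr ?opprK//.
Qed.

Lemma cos_gdist x y : sphere x -> sphere y -> cos (gdist x y) = dot x y.
Proof. by move=> xx yy; rewrite acosK// in_itv/= sphere_dot_bound. Qed.

Lemma gdist_bound x y : sphere x -> sphere y -> 0 <= gdist x y <= pi.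
Proof. by move=> xx yy; rewrite acos_ge0 ?acos_lepi// sphere_dot_bound. Qed.

Lemma gdist_eq0 x y : sphere x -> sphere y -> gdist x y = 0 -> x = y.
Proof.
move=> xx yy d0; apply/eqP; rewrite -subr_eq0 -dot_eq0.
have d1 : dot x y = 1 by rewrite -cos_gdist// d0 cos0.
rewrite !(dotBl, dotBr) (dotC y x) d1 [dot x x]xx [dot y y]yy.
by rewrite !subrr.
Qed.

Lemma gdist_eq_pi x y : sphere x -> sphere y -> gdist x y = pi -> x = - y.
Proof.
move=> xx yy d0; apply/eqP; rewrite -addr_eq0 -dot_eq0.
have d1 : dot x y = -1 by rewrite -cos_gdist// d0 cospi.
rewrite !(dotDl, dotDr) (dotC y x) d1 [dot x x]xx [dot y y]yy.
by apply/eqP; ring.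
Qed.

(** The distance is realized along the meridian of [theta], well defined as [theta] is neither pole;
    the lower bound on the whole parallel is Cauchy-Schwarz for the components orthogonal to the
    pole. *)
Lemma betaE (alpha : R) theta : (0 < n)%N -> 0 <= alpha <= pi -> sphere theta ->
  0 < gdist npole theta < pi ->
  beta alpha theta = `|alpha - gdist npole theta|.
Proof.
move=> n0 /andP[a0 api] st; set delta := gdist _ _ => /andP[d0 dpi].
have se := sphere_npole n0; pose e : 'rV[R]_n := npole.
have ee : dot e e = 1 by exact: se.
have tt : dot theta theta = 1 by [].
have et : dot e theta = cos delta by rewrite cos_gdist.
have sd0 : 0 < sin delta by rewrite sin_gt0_pi// d0.
have sa0 : 0 <= sin alpha by rewrite sin_ge0_pi// a0.
have b_itv : `|alpha - delta| \in `[0, pi].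
  rewrite in_itv/= normr_ge0/= ler_norml; apply/andP; split; lra.
(* The point of the parallel on the meridian of [theta]; [sin delta] is the length of the component
   of [theta] orthogonal to the pole. *)
pose y0 := cos alpha *: e + (sin alpha / sin delta) *: (theta - cos delta *: e).
have ey0 : dot e y0 = cos alpha.
  rewrite /y0 !(dotDr, dotZr, dotNr) ee et; ring.
have y0y0 : dot y0 y0 = 1.
  rewrite {1}/y0 dotDl !(dotZl, dotBl) ey0 /y0 !(dotDr, dotZr, dotNr) tt (dotC theta e) et.
  transitivity (cos alpha ^+ 2 + sin alpha ^+ 2 / sin delta ^+ 2 * (1 - cos delta ^+ 2)).
    by field; rewrite gt_eqF.
  rewrite -sin2cos2 divfK ?cos2Dsin2// expf_neq0// gt_eqF//.
have ty0 : dot theta y0 = cos (alpha - delta).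
  rewrite /y0 !(dotDr, dotZr, dotNr) tt (dotC theta e) et cosB.
  transitivity (cos alpha * cos delta + sin alpha / sin delta * (1 - cos delta ^+ 2)).
    by ring.
  by rewrite -sin2cos2; field; rewrite gt_eqF.
have Py0 : parallel alpha y0.
  by split => //; rewrite /gdist ey0 cosK// in_itv/= a0.
have gy0 : gdist theta y0 = `|alpha - delta|.
  by rewrite /gdist ty0 -cos_norm cosK.
have lb y : parallel alpha y -> `|alpha - delta| <= gdist theta y.
  move=> [sy ey].
  have ey' : dot e y = cos alpha by rewrite -ey cos_gdist.
  have gb : gdist theta y \in `[0, pi] by rewrite in_itv/= gdist_bound.
  (* Cosine decreases on [0, pi], so the lower bound on the distance becomes an upper bound on
     [dot theta y]. *)
  rewrite leNgt -ltr_cos// -leNgt cos_norm cos_gdist// cosB.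
  have E1 : dot (theta - cos delta *: e) (theta - cos delta *: e) = sin delta ^+ 2.
    by rewrite [RHS]sin2cos2 !(dotBl, dotBr, dotZl, dotZr) ee tt (dotC theta e) et; ring.
  have E2 : dot (y - cos alpha *: e) (y - cos alpha *: e) = sin alpha ^+ 2.
    by rewrite [RHS]sin2cos2 !(dotBl, dotBr, dotZl, dotZr) ee (dotC y e) ey' [dot y y]sy; ring.
  have E3 : dot (theta - cos delta *: e) (y - cos alpha *: e) =
      dot theta y - cos alpha * cos delta.
    by rewrite !(dotBl, dotBr, dotZl, dotZr) ee (dotC theta e) et ey'; ring.
  have := cauchy_schwarz (ltW sd0) sa0 E1 E2.
  by rewrite E3 lerBlDl [sin alpha * _]mulrC.
rewrite /beta /gdist_set; apply/eqP; rewrite eq_le; apply/andP; split.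
  rewrite -gy0; apply: ge_inf; last by exists y0.
  by exists `|alpha - delta| => _ [y Py <-]; exact: lb.
apply: lb_le_inf; first by exists (gdist theta y0), y0.
by move=> _ [y Py <-]; exact: lb.
Qed.

(** The point of contact [p] lies on the section, which gives it a direction [eta] in [xi], and on
    the parallel, which gives it the height [cos alpha]. *)
Lemma tangent_point (alpha : R) k (C : set 'rV[R]_n) theta xi :
    (0 < n)%N -> tangent_sections alpha k C (slice alpha theta xi) ->
  exists eta, [/\ sphere eta, eta \in xi &
    sin (beta alpha theta) * dot eta npole +
    cos (beta alpha theta) * dot theta npole = cos alpha].
Proof.
move=> n0 [p [V [_ [[sp gp] _] _ sE _]]].
have : slice alpha theta xi p.
  by rewrite sE; split => //; exists 0; rewrite /= ?mem0v ?addr0.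
move=> [eta [seta etaxi] pE]; exists eta; split => //.
have <- : dot p npole = cos alpha.
  by rewrite dotC -cos_gdist ?gp//; exact: sphere_npole.
by rewrite -pE dotDl !dotZl.
Qed.

(** The components along the orthonormal vectors [theta] and [eta] already exhaust the unit norm of
    the pole, so the remainder has norm 0. *)
Lemma polar_decomposition theta eta (delta c : R) :
    (0 < n)%N -> sphere theta -> sphere eta -> dot eta theta = 0 ->
    dot theta npole = cos delta -> dot eta npole = c -> c ^+ 2 = sin delta ^+ 2 ->
  npole = cos delta *: theta + c *: eta.
Proof.
move=> n0 tt hh ht te he c2; have ee := sphere_npole n0.
apply/eqP; rewrite -subr_eq0 -dot_eq0; apply/eqP.
rewrite !(dotBl, dotDl, dotZl, dotBr, dotDr, dotZr) [dot theta theta]tt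
  [dot eta eta]hh [dot npole npole]ee (dotC theta eta) ht
  (dotC npole theta) te (dotC npole eta) he.
transitivity (1 - (cos delta ^+ 2 + c ^+ 2)); first by ring.
by rewrite c2 cos2Dsin2 subrr.
Qed.

End sphere_geometry.

(** Common to both caps: [zeta] is the direction in [xi] toward the pole, and the height on the
    section is affine in the coordinate along [zeta], with extreme values [cos (b + delta)] and
    [cos (b - delta)]. *)
Lemma slice_transform_zonal (R : realType) (n k : nat) (alpha delta : R)
    (f0 : R -> R) (f : 'rV[R]_n -> R) (theta zeta : 'rV[R]_n)
    (xi : {vspace 'rV[R]_n}) :
    let b := beta alpha theta in
    (0 < n)%N -> measurable_fun (`[-1, 1] : set R) f0 ->
    (forall eta : 'rV[R]_n, sphere eta -> f eta = f0 (lastc eta)) ->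
    sphere theta -> grass_perp k.+2 theta xi ->
    0 < sin b -> 0 < sin delta -> sphere zeta -> zeta \in xi ->
    npole = cos delta *: theta + sin delta *: zeta ->
  (slice_transform alpha k.+2 f theta xi =
   ((@sphere_area R k.+2)^-1 *
    (@sphere_area R k.+1 * (sin b * sin delta) `^ (2 - k.+2%:R)))%:E *
   \int[@lebesgue_measure R]_(s in `](cos (b + delta))%R, (cos (b - delta))%R[)
     (f0 s * ((s - cos (b + delta)) * (cos (b - delta) - s))
               `^ ((k.+2%:R - 3) / 2))%:E)%E.
Proof.
move=> b n0 mf0 hf st [dxi xip] sb sd sz zxi nE.
pose A := cos b * cos delta; pose B := sin b * sin delta.
have -> : cos (b + delta) = A - B by rewrite cosD.
have -> : cos (b - delta) = A + B by rewrite cosB.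
have B0 : 0 < B by exact: mulr_gt0.
have AB1 : -1 <= A - B by rewrite -cosD cos_geN1.
have AB2 : A + B <= 1 by rewrite -cosB cos_le1.
have mI : measurable (`[-1, 1]%classic : set R) by [].
(* Measurability of [f0] is given on [-1, 1] only; the extension by 0 is measurable everywhere and
   agrees with [f0] at all heights on the sphere. *)
pose g : R -> R := f0 \_ `[-1, 1].
have mg : measurable_fun setT g by apply/(measurable_restrictT _ mI).
have gE s : -1 <= s <= 1 -> g s = f0 s.
  by move=> s1; rewrite /g patchE mem_set//= in_itv.
have obX := orthobasisP dxi; set X := orthobasis k.+2 xi in obX.
pose w := [tuple dot (tnth X i) zeta | i < k.+2].
have w1 : tsq w = 1 by rewrite (orthobasis_expand obX zxi); exact: sz.
rewrite /slice_transform /sphere_integral -/b -/X EFinM -muleA; congr (_ * _)%E.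
transitivity (\int[@sphere_measure R k.+2]_(x in [set x | tnorm x = 1%R])
    (g (A + B * tdot w x)%R)%:E)%E; last first.
  rewrite (integral_sphere_affine A w1 B0 mg); congr (_ * _)%E.
  apply: eq_integral => s; rewrite inE /= in_itv/= => /andP[s1 s2].
  by rewrite gE// (le_trans AB1 (ltW s1)) (le_trans (ltW s2) AB2).
apply: eq_integral => x; rewrite inE /= => x1; congr (_%:E).
have [] := orthobasis_sum x obX; set eta := \sum_(i < k.+2) _ => etaxi etaE.
have seta : dot eta eta = 1.
  by rewrite etaE -[tsq x]sqr_sqrtr ?tsq_ge0// -/(tnorm x) [tnorm x]x1 expr1n.
have eta_t : dot eta theta = 0 by exact: xip.
have zt : dot zeta theta = 0 by exact: xip.
have tt : dot theta theta = 1 by [].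
have sy : sphere (sin b *: eta + cos b *: theta).
  rewrite /sphere /= !(dotDl, dotDr, dotZl, dotZr) seta tt (dotC theta) eta_t.
  by rewrite -[RHS](cos2Dsin2 b); ring.
have yE : lastc (sin b *: eta + cos b *: theta) = A + B * tdot w x.
  rewrite /lastc nE !(dotDl, dotDr, dotZl, dotZr) tt eta_t (dotC theta) zt.
  have -> : dot eta zeta = tdot w x.
    rewrite dot_suml; apply: eq_bigr => i _.
    by rewrite tnth_mktuple dotZl mulrC.
  by rewrite /A /B; ring.
rewrite hf// yE gE// -yE; exact: (sphere_dot_bound sy (sphere_npole n0)).
Qed.

(** The powers of [pi] in the two areas differ by a square root and the factors 2 cancel; of the two
    Gamma values left, one belongs to the factor [u] and the other to [Phi]. *)
Lemma sphere_area_ratio (R : realType) (k : nat) (x : R) :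
  (@sphere_area R k.+2)^-1 * (@sphere_area R k.+1 * x) =
  euler_Gamma (k.+2%:R / 2) / pi `^ (1 / 2) * x *
  (euler_Gamma ((k.+2%:R - 1) / 2))^-1.
Proof.
have [_ G2] := radial_const_area R k.+1; have [_ G1] := radial_const_area R k.
have -> : (k.+2%:R - 1) / 2 = k.+1%:R / 2 :> R by rewrite -(natr1 k.+1) addrK.
have pi2 : (pi : R) `^ (k.+2%:R / 2) = pi `^ (k.+1%:R / 2) * pi `^ (1 / 2).
  rewrite -powRD ?(gt_eqF (pi_gt0 R)) ?implybT//.
  by rewrite -mulrDl natr1.
have p1 : 0 < (pi : R) `^ (k.+1%:R / 2) by rewrite powR_gt0// pi_gt0.
have p2 : 0 < (pi : R) `^ (1 / 2) by rewrite powR_gt0// pi_gt0.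
rewrite /sphere_area pi2.
move: G1 G2 p1 p2; move: (euler_Gamma _) (euler_Gamma _) (_ `^ _) (_ `^ _).
by move=> g1 g2 q1 q2 *; field; rewrite !gt_eqF.
Qed.

Theorem lemma5p1 (R : realType) (n k : nat) (alpha : R)
    (f0 : R -> R) (f : 'rV[R]_n -> R)
    (hn : (3 <= n)%N) (hk : (2 <= k <= n.-1)%N)
    (halpha : 0 < alpha < pi)
    (mf0 : measurable_fun (`[-1, 1] : set R) f0)
    (hf : forall eta : 'rV[R]_n, sphere eta -> f eta = f0 (lastc eta)) :
  (forall (theta : 'rV[R]_n) (xi : {vspace 'rV[R]_n}),
     cap_plus alpha theta -> theta != npole ->
     grass_perp k theta xi ->
     tangent_sections alpha k (cap_plus alpha) (slice alpha theta xi) ->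
     slice_transform alpha k f theta xi =
       ((u_plus k alpha theta)%:E *
        Phi_plus k (cos alpha) f0 (v_plus alpha theta))%E)
  /\
  (forall (theta : 'rV[R]_n) (xi : {vspace 'rV[R]_n}),
     cap_minus alpha theta -> theta != - npole ->
     grass_perp k theta xi ->
     tangent_sections alpha k (cap_minus alpha) (slice alpha theta xi) ->
     slice_transform alpha k f theta xi =
       ((u_minus k alpha theta)%:E *
        Phi_minus k (cos alpha) f0 (v_minus alpha theta))%E).
Proof.
have n0 : (0 < n)%N by exact: leq_trans hn.
case: k hk => [|[|k]]// _; move/andP: halpha => [a0 api].
have a_itv : 0 <= alpha <= pi by rewrite !ltW.
have se : sphere (npole : 'rV[R]_n) := sphere_npole n0.
split=> theta xi [st] + tn gxi tgt; set delta := gdist npole theta => da.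
- have /andP[d0' dpi'] := gdist_bound se st.
  have d0 : 0 < delta.
    rewrite lt_neqAle d0' andbT eq_sym; apply: contraNneq tn => d.
    by rewrite (gdist_eq0 se st d).
  have dpi : delta < pi by exact: lt_trans da api.
  have bE : beta alpha theta = alpha - delta.
    by rewrite betaE ?d0// ger0_norm// subr_ge0 ltW.
  have sd : 0 < sin delta by rewrite sin_gt0_pi// d0.
  have sb : 0 < sin (beta alpha theta).
    by rewrite bE sin_gt0_pi// subr_gt0 da/= ltrBlDr (lt_trans api)// ltrDl.
  have te : dot theta npole = cos delta by rewrite dotC cos_gdist.
  have [eta [seta etaxi etaE]] := tangent_point n0 tgt.
  (* The contact is on the side of [theta] away from the pole, since [alpha] is [delta] plus the
     radius of the section. The direction toward the pole is therefore [- eta]. *)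
  have he : dot eta npole = - sin delta.
    apply: (mulfI (lt0r_neq0 sb)).
    have : cos alpha = cos (beta alpha theta + delta) by rewrite bE subrK.
    by rewrite -etaE te cosD => /(canRL (addrK _)) ->; ring.
  have nE := polar_decomposition n0 st seta (gxi.2 _ etaxi) te he (sqrrN _).
  rewrite (@slice_transform_zonal R n k alpha delta f0 f theta (- eta) xi)//.
  + rewrite sphere_area_ratio EFinM -muleA /u_plus /Phi_plus /v_plus.
    have -> : alpha - beta alpha theta = delta by rewrite bE opprB addrC subrK.
    (* The lower endpoint is the height of the parallel; the upper one, [v_plus], is the height of
       the point of the section opposite to the contact. *)
    have -> : cos (beta alpha theta + delta) = cos alpha by rewrite bE subrK.
    have -> : cos (alpha - 2 * beta alpha theta) = cos (beta alpha theta - delta).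
      by rewrite -cosN bE; congr cos; ring.
    congr (_ * (_ * _))%E; apply: eq_integral => s.
    rewrite inE /= in_itv/= => /andP[s1 s2]; congr (_%:E).
    by rewrite /f1 powRM ?subr_ge0 ?ltW// gtr0_norm ?subr_gt0// mulrA.
  + by rewrite /sphere /= dotNl dotNr opprK.
  + by rewrite rpredN.
  + by rewrite nE scalerN scaleNr.
- have /andP[d0' dpi'] := gdist_bound se st.
  have d0 : 0 < delta by exact: lt_trans da.
  have dpi : delta < pi.
    rewrite lt_neqAle dpi' andbT; apply: contraNneq tn => d.
    by rewrite (gdist_eq_pi se st d) opprK.
  have bE : beta alpha theta = delta - alpha.
    by rewrite betaE ?d0// ltr0_norm ?opprB// subr_lt0.
  have sd : 0 < sin delta by rewrite sin_gt0_pi// d0.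
  have sb : 0 < sin (beta alpha theta).
    by rewrite bE sin_gt0_pi// subr_gt0 da/= ltrBlDr (lt_trans dpi)// ltrDl.
  have te : dot theta npole = cos delta by rewrite dotC cos_gdist.
  have [eta [seta etaxi etaE]] := tangent_point n0 tgt.
  (* Now the contact is on the side of [theta] toward the pole, so [eta] itself is the required
     direction and the parallel gives the upper endpoint. *)
  have bd : cos (beta alpha theta - delta) = cos alpha.
    by rewrite -cosN bE; congr cos; ring.
  have he : dot eta npole = sin delta.
    apply: (mulfI (lt0r_neq0 sb)); move: bd.
    by rewrite -etaE te cosB addrC => /addIr ->.
  have nE := polar_decomposition n0 st seta (gxi.2 _ etaxi) te he erefl.
  rewrite (@slice_transform_zonal R n k alpha delta f0 f theta eta xi)//.
  rewrite sphere_area_ratio EFinM -muleA /u_minus /Phi_minus /v_minus.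
  have -> : alpha + beta alpha theta = delta by rewrite bE addrC subrK.
  have -> : cos (alpha + 2 * beta alpha theta) = cos (beta alpha theta + delta).
    by rewrite bE; congr cos; ring.
  rewrite bd; congr (_ * (_ * _))%E; apply: eq_integral => s.
  rewrite inE /= in_itv/= => /andP[s1 s2]; congr (_%:E).
  rewrite /f1 powRM ?subr_ge0 ?ltW// ltr0_norm ?subr_lt0// opprB -mulrA.
  by congr (_ * _); rewrite mulrC.
Qed.
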